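(* For every integer partition $\lambda$ of a positive integer and every $\alpha\in\mathbb{R}$, $$\eta^\lambda_\alpha = (-1)^{|\lambda|-\lambda_1}\, D^\lambda_\alpha .$$
   Context: Jack characters and Jack derangement sums. For a real parameter $\alpha$, the integral form Jack polynomials $J_\lambda=J_\lambda(x;\alpha)$ ($\lambda$ ranging over integer partitions) form the unique basis of the ring of symmetric functions in $x=x_1,x_2,\dots$ such that: (i) $\langle J_\lambda,J_\mu\rangle_\alpha=0$ if $\lambda\ne\mu$, where $\langle p_\lambda,p_\mu\rangle_\alpha=\delta_{\lambda,\mu}\alpha^{\ell(\lambda)}z_\lambda$ on power sums, with $z_\lambda=\prod_i i^{m_i}m_i!$, $m_i$ being the number of parts of $\lambda$ equal to $i$, and $\ell(\lambda)$ the number of parts; (ii) $J_\lambda=\sum_{\mu\trianglelefteq\lambda}c_{\lambda\mu}m_\mu$, where $m_\mu$ are the monomial symmetric functions and $\trianglelefteq$ is dominance order; (iii) the coefficient of $m_{1^n}$ in $J_\lambda$ is $n!$ for $\lambda\vdash n$. Write $J_\lambda=\sum_{\mu\vdash n}\theta^\lambda_\alpha(\mu)p_\mu$ for $\lambda\vdash n$. The coefficients $\theta^\lambda_\alpha(\mu)$ are polynomials in $\alpha$, and for values of $\alpha$ at which the characterization above degenerates (e.g. $\alpha=0$) $\theta^\lambda_\alpha(\mu)$ means the value of this polynomial. Let $\mathrm{fp}(\mu)$ be the number of parts of $\mu$ equal to $1$. For $\lambda\vdash n$ define $$\eta^\lambda_\alpha:=\sum_{\mu\vdash n,\ \mathrm{fp}(\mu)=0}\theta^\lambda_\alpha(\mu).$$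 Colored derangements and Jack derangement numbers. Let $\lambda'$ be the conjugate partition of $\lambda$ and $[m]=\{1,\dots,m\}$. Let $$\mathcal{S}_\lambda=\{(c,\sigma): c\in[\lambda'_1]\times\cdots\times[\lambda'_{\lambda_1}],\ \sigma\in S_{\lambda_1},\ \sigma(i)=j\Rightarrow c_i=c_j\ \text{for all } i\in[\lambda_1]\}$$ (so each cycle of $\sigma$ is monochromatic). An element $(c,\sigma)\in\mathcal{S}_\lambda$ is a derangement if $\sigma(i)=i$ implies $c_i\neq 1$ for all $1\le i\le\lambda_1$. Let $d^\lambda_k$ be the number of derangements $(c,\sigma)\in\mathcal{S}_\lambda$ such that $\sigma$ has exactly $k$ disjoint cycles (fixed points count as cycles). Define $$D^\lambda_\alpha:=\sum_{k=1}^{\lambda_1}d^\lambda_k\,\alpha^{\lambda_1-k},$$ with $0^0=1$. *)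

(* Defs.v *)
From HB Require Import structures.
From mathcomp Require Import all_boot all_order all_algebra all_fingroup.
From mathcomp Require Import reals.
From mathcomp Require Import mpoly.

Set Implicit Arguments.
Unset Strict Implicit.
Unset Printing Implicit Defensive.

Import Order.TTheory GRing.Theory Num.Theory.
Local Open Scope ring_scope.

(* Partitions of n as weakly decreasing sequences of positive integers. The
   bounds built into n.-bseq 'I_n.+1 (at most n parts, each at most n) exclude
   nothing; they only make the type finite. *)
Definition is_intpart n (s : n.-bseq 'I_n.+1) : bool :=
  let t := [seq val i | i <- s] in
  [&& sorted geq t, 0%N \notin t & sumn t == n].

Record intpart (n : nat) : predArgType :=
  IntPart { intpart_bseq : n.-bseq 'I_n.+1; _ : is_intpart intpart_bseq }.

HB.instance Definition _ n := [isSub for @intpart_bseq n].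
HB.instance Definition _ n := [Finite of intpart n by <:].

Coercion parts n (mu : intpart n) : seq nat :=
  [seq val i | i <- intpart_bseq mu].

(* mu_1, with value 0 on the empty partition *)
Definition part1 n (mu : intpart n) : nat := head 0%N mu.

(* mu'_j for j >= 1: the number of parts that are at least j *)
Definition conj_part n (mu : intpart n) (j : nat) : nat := count (leq j) mu.

Definition part_mult n (mu : intpart n) (i : nat) : nat := count_mem i mu.

Definition zee n (mu : intpart n) : nat :=
  (\prod_(1 <= i < n.+1) (i ^ part_mult mu i * (part_mult mu i)`!))%N.

(* The partial sums of both partitions are constant (equal to n) beyond n. *)
Definition dominated n (mu la : intpart n) : bool :=
  [forall k : 'I_n.+1, sumn (take k mu) <= sumn (take k la)]%N.

Section SymmetricFunctions.
Variable R : realType.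

(* A symmetric function homogeneous of degree n, given by its coordinates
   f mu in the basis (p_mu) of power sums, mu ranging over partitions of n. *)
Definition symf (n : nat) := {ffun intpart n -> R^o}.

Definition psum (N n : nat) (mu : intpart n) : {mpoly R[N]} :=
  \prod_(k <- mu) (\sum_(i < N) 'X_i ^+ k).

Definition symf_eval (N n : nat) (f : symf n) : {mpoly R[N]} :=
  \sum_(mu : intpart n) f mu *: psum N mu.

(* The monomial symmetric polynomial: the sum of the distinct x^a whose
   exponent vector a, with its zero entries removed, is a rearrangement of mu
   (hence 0 if N is smaller than the length of mu). *)
Definition monsym (N n : nat) (mu : intpart n) : {mpoly R[N]} :=
  \sum_(a : 'X_{1..N < n.+1} |
         perm_eq [seq k <- (a : 'X_{1..N}) | k != 0%N] mu) 'X_[a].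

(* The bilinear extension of
   <p_mu, p_nu> = delta_{mu, nu} alpha^{l(mu)} z_mu. *)
Definition jack_dot (alpha : R) n (f g : symf n) : R :=
  \sum_(mu : intpart n) f mu * g mu * (alpha ^+ size mu * (zee mu)%:R).

(* f = \sum_mu c_mu m_mu as symmetric functions in infinitely many variables,
   i.e. after restriction to any number N of variables. *)
Definition monomial_expansion n (f : symf n) (c : intpart n -> R) : Prop :=
  forall N : nat,
    symf_eval N f = \sum_(mu : intpart n) c mu *: monsym N mu.

Definition symf_basis n (J : intpart n -> symf n) : Prop :=
  forall f : symf n,
    exists! c : {ffun intpart n -> R}, f = \sum_(la : intpart n) c la *: J la.

(* The characterization of the integral form Jack basis at alpha. Symmetric
   functions of different degrees are orthogonal and in direct sum, so that
   orthogonality and the basis property are stated degree by degree. *)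
Record is_jack (alpha : R) (J : forall n, intpart n -> symf n) : Prop := IsJack {
  jack_basis : forall n, symf_basis (@J n);
  jack_orthogonal : forall n (la mu : intpart n),
    la != mu -> jack_dot alpha (J n la) (J n mu) = 0;
  jack_monomial : forall n (la : intpart n),
    exists c : intpart n -> R,
      [/\ monomial_expansion (J n la) c,
          forall mu, ~~ dominated mu la -> c mu = 0
        & forall mu, parts mu = nseq n 1%N -> c mu = n`!%:R] }.

(* theta n la mu is the polynomial in alpha giving the coefficient of p_mu in
   J_la(x; alpha). The inner product is positive definite for alpha > 0, where
   the characterization therefore determines J; this pins down the polynomials
   theta, whose values then make sense at every real alpha. *)
Definition is_jack_theta
    (theta : forall n, intpart n -> intpart n -> {poly R}) : Prop :=
  forall alpha : R, 0 < alpha ->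
    is_jack alpha (fun n la => [ffun mu => (theta n la mu).[alpha]]).

Definition jack_eta (theta : forall n, intpart n -> intpart n -> {poly R})
    n (la : intpart n) (alpha : R) : R :=
  \sum_(mu : intpart n | part_mult mu 1 == 0%N) (theta n la mu).[alpha].

End SymmetricFunctions.

(* The position i : 'I_(part1 la) stands for i + 1 in [la_1]; the colours keep
   their values 1, ..., la'_(i + 1), which never exceed n. *)
Notation colored_perm n la :=
  ({ffun 'I_(part1 la) -> 'I_n.+1} * {perm 'I_(part1 la)})%type.

Definition colored_perms n (la : intpart n) : {set colored_perm n la} :=
  [set cs : colored_perm n la |
    [forall i, (0 < cs.1 i <= conj_part la i.+1)%N]
    && [forall i, cs.1 i == cs.1 (cs.2 i)]].

Definition colored_derangements n (la : intpart n) : {set colored_perm n la} :=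
  [set cs in colored_perms la |
    [forall i, (cs.2 i == i) ==> (val (cs.1 i) != 1%N)]].

(* fixed points are singleton orbits, so porbits counts them as cycles *)
Definition derangements_cycles n (la : intpart n) (k : nat) : nat :=
  #|[set cs in colored_derangements la | #|porbits cs.2| == k]|.

Definition jack_derangement (R : realType) n (la : intpart n) (alpha : R) : R :=
  \sum_(1 <= k < (part1 la).+1)
    (derangements_cycles la k)%:R * alpha ^+ (part1 la - k).

(* Main.v *)
(* For alpha > 0 write g_k for 1/(n-k)! times the coefficient of m_(k,1^(n-k)) in J_la.
   Setting p_1 = 0 and p_i = 1 for i >= 2 turns J_la into sum_k (-1)^(n-k) g_k, so it
   suffices to compute the hook coefficients g_k.

   Adjoin one more variable x_0 to the symmetric functions and let L be the Lax operator of
   Nazarov and Sklyanin.  Up to weights it is a symmetric matrix in the basis x_0^a p_nu, and in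
   the variables x_0, x_1, ... it is a Cherednik operator, which is triangular for dominance.
   Hence f |-> [x_0^0] (X - L)^-1 f is self-adjoint and triangular, so J_la is an eigenvector;
   its eigenvalue tau(X) is read off on the orbit of the monomial x^la.  Comparing in
   (X - L) Z = J_la the coefficients of x_0^k x_1 ... x_(n-k) gives a closed first-order
   recursion in k, whose solvability forces
     (X - alpha la_1) tau(X) P(X) = P(X - alpha),
   where P(X) = sum_k g_k prod_(k <= i < la_1) (X - alpha i).  Being monic, P is therefore
   prod_j (X - alpha (j-1) + la'_j), and expanding this product over sets of columns gives g_k as
   a sum over k-element sets of columns of products of first-row hook lengths.  The same products
   count the coloured permutations that are supported on a given set of columns, by insertion of
   the columns from right to left, and inclusion-exclusion over the fixed points of colour 1
   yields the derangement numbers. *)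

Require Import Defs.
From HB Require Import structures.
From mathcomp Require Import all_boot all_order all_algebra all_fingroup.
From mathcomp Require Import reals.
From mathcomp Require Import mpoly.
From mathcomp Require Import zify ring.

Set Implicit Arguments.
Unset Strict Implicit.
Unset Printing Implicit Defensive.

Import Order.TTheory GRing.Theory Num.Theory.
Local Open Scope ring_scope.

(** * Partitions and dominance *)

(** The Jack functions enter only through orthogonality, triangularity and normalisation, so the
    hook coefficients must come from an operator that is self-adjoint and triangular at once.
    Self-adjointness is visible on power sums, triangularity on monomials; the operator is therefore
    written twice, as the matrix [lax] and as [cherednik] acting on coefficients, and [expand_laxop]
    identifies the two. It creates powers of x_0, so it does not act on symmetric functions; the
    part of its resolvent with x_0-power zero does, hence the detour through (X - L)^-1. The bound X
    > alpha n keeps every factor X - alpha r + (a count) positive, which makes X - L invertible and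
    the later divisions legitimate. Hooks are the monomials on which the equations close up: an
    exponent 1 admits a single exchange with x_0. The variables x_1, ..., x_n beside x_0 suffice to
    separate the p_nu with |nu| <= n. All this lives at alpha > 0; both sides of the theorem are
    polynomials in alpha, so agreement at 1, 2, 3, ... covers every real alpha. *)

Section Excess.
Local Open Scope nat_scope.

(* Dominance in terms of these convex functionals: they are insensitive to the order of the
   entries and to zero entries. *)
Definition excess t (s : seq nat) := \sum_(k <- s) (k - t).

Definition dom (s u : seq nat) := forall t, excess t s <= excess t u.

Lemma excess_perm t s u : perm_eq s u -> excess t s = excess t u.
Proof. exact: perm_big. Qed.

Lemma excess_nz t s : excess t [seq k <- s | k != 0] = excess t s.
Proof.
rewrite /excess big_filter big_mkcond /=; apply: eq_bigr => k _.
by case: k.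
Qed.

Lemma excess_cat t s u : excess t (s ++ u) = excess t s + excess t u.
Proof. by rewrite /excess big_cat. Qed.

Lemma excess_lower t s : sumn s <= excess t s + t * size s.
Proof.
elim: s => [|k s IH] //=; rewrite /excess big_cons -/(excess t s) /=; lia.
Qed.

Lemma excess_upper t s : all (geq t) s -> excess t s = 0.
Proof.
move=> Hall; have Hs := allP Hall; rewrite /excess big_seq big1 // => k /Hs /=; lia.
Qed.

Lemma excess_exact t s : all (leq t) s -> excess t s + t * size s = sumn s.
Proof.
elim: s => [|k s IH] /=; first by rewrite /excess big_nil muln0.
by move=> /andP[tk /IH]; rewrite /excess big_cons -/(excess t s); lia.
Qed.

Lemma geq_trans : transitive geq.
Proof. move=> a b c /= h1 h2; exact: leq_trans h2 h1. Qed.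

Lemma sorted_geq_take t s : sorted geq s -> exists k,
  all (leq t.+1) (take k s) && all (geq t) (drop k s).
Proof.
elim: s => [|a s IH] /= Hs; first by exists 0.
case: (leqP a t) => [ta|ta].
  exists 0; rewrite take0 drop0 /= ta /=.
  have := order_path_min geq_trans Hs; apply: sub_all => x /= h; exact: leq_trans h ta.
have [k /andP[h1 h2]] := IH (path_sorted Hs).
by exists k.+1; rewrite /= ta h1 h2.
Qed.

(** For a threshold [t], let [k] count the entries of [s] above [t]: the excess of [s] is then its
    k-th partial sum minus [t * k], and the same expression for [u] is a lower bound of the excess
    of [u]. *)
Lemma dom_of_take s u : sorted geq s ->
  (forall k, sumn (take k s) <= sumn (take k u)) -> sumn s = sumn u -> dom s u.
Proof.
move=> Hs H Hsu t; have [k /andP[h1 h2]] := sorted_geq_take t Hs.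
rewrite -{1}(cat_take_drop k s) excess_cat (excess_upper h2) addn0.
have e1 := excess_exact (sub_all (fun x => @ltnW t x) h1).
have := excess_lower t (take k u).
have : excess t (take k u) <= excess t u.
  by rewrite -{2}(cat_take_drop k u) excess_cat leq_addr.
have := H k.
have [hk|hk] := leqP k (size s).
  rewrite (size_takel hk) in e1.
  have : size (take k u) <= k by rewrite size_take; case: ltnP => // ; lia.
  nia.
move: e1; rewrite take_oversize; last exact: ltnW.
have [hu|hu] := leqP (size u) (size s).
  rewrite [take k u]take_oversize; last lia.
  nia.
have := excess_lower t (take (size s) u); have := H (size s).
rewrite take_size size_takel; last lia.
have : excess t (take (size s) u) <= excess t u.
  by rewrite -{2}(cat_take_drop (size s) u) excess_cat leq_addr.
nia.
Qed.

(** The threshold is the entry of [u] at position [k]: there the bound [excess_lower] for the first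
    [k] entries is an equality for the sorted [u], and it still bounds the partial sum of [s]. *)
Lemma take_of_dom s u : sorted geq u -> dom s u -> sumn s = sumn u ->
  forall k, sumn (take k s) <= sumn (take k u).
Proof.
move=> Hu H Hsu k.
have [hk|hk] := leqP (size u) k.
  rewrite [take k u]take_oversize // -Hsu -{2}(cat_take_drop k s) sumn_cat; lia.
set t := nth 0 u k.
have h1 : all (leq t) (take k u).
  apply/(all_nthP 0) => i; rewrite size_takel; last lia.
  move=> ik; rewrite nth_take //.
  by apply: (sorted_leq_nth geq_trans leqnn 0 Hu) => //; rewrite ?inE; lia.
have h2 : all (geq t) (drop k u).
  apply/(all_nthP 0) => i; rewrite size_drop => ik; rewrite nth_drop.
  by apply: (sorted_leq_nth geq_trans leqnn 0 Hu) => //; rewrite ?inE; lia.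
have e := excess_exact h1; rewrite size_takel in e; last lia.
have := H t; rewrite -{1}(cat_take_drop k u) excess_cat (excess_upper h2) addn0.
rewrite -{1}(cat_take_drop k s) excess_cat.
have := excess_lower t (take k s).
have : size (take k s) <= k by rewrite size_take; case: ltnP => // ; lia.
nia.
Qed.

Lemma dom_trans s u v : dom s u -> dom u v -> dom s v.
Proof. by move=> h1 h2 t; exact: leq_trans (h1 t) (h2 t). Qed.

Lemma take_inj s u : 0 \notin s -> 0 \notin u ->
  (forall k, sumn (take k s) = sumn (take k u)) -> s = u.
Proof.
move=> s0 u0 H.
have hn k : nth 0 s k = nth 0 u k.
  have := H k.+1; have := H k.
  have e (w : seq nat) : sumn (take k.+1 w) = sumn (take k w) + nth 0 w k.
    by elim: w k {H} => [|a w IH] [|k] //=; rewrite ?take0 ?IH ?addnA ?addn0.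
  by rewrite !e => -> /addnI.
have hs (v w : seq nat) : 0 \notin v -> (forall k, nth 0 v k = nth 0 w k) -> size v <= size w.
  move=> v0 h; rewrite leqNgt; apply/negP => hlt.
  have := mem_nth 0 hlt; rewrite h nth_default // => v0'.
  by rewrite v0' in v0.
have hsz : size s = size u by apply/eqP; rewrite eqn_leq !hs // => j; rewrite hn.
by apply: (@eq_from_nth _ 0 s u hsz) => i _; rewrite hn.
Qed.

Lemma leq_sumn k s : k \in s -> k <= sumn s.
Proof. elim: s => //= a s IH; rewrite inE => /orP[/eqP->|/IH]; lia. Qed.

Definition isort (s : seq nat) := [&& sorted geq s & 0 \notin s].

Lemma dom_antisym s u : isort s -> isort u -> sumn s = sumn u ->
  dom s u -> dom u s -> s = u.
Proof.
move=> /andP[hs s0] /andP[hu u0] e h1 h2; apply: take_inj => // k.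
apply/eqP; rewrite eqn_leq !take_of_dom //.
Qed.

(** Convexity: moving two entries apart at constant sum cannot lower the excess. It strictly raises
    it at [t = maxn r s], where the original pair contributes 0. *)
Lemma excess_spread t r s i : i < minn r s ->
  (r - t) + (s - t) <= ((r + s - i) - t) + (i - t).
Proof. lia. Qed.

Lemma excess_spread_strict r s i (t := maxn r s) : i < minn r s ->
  (r - t) + (s - t) < ((r + s - i) - t) + (i - t).
Proof. rewrite /t; lia. Qed.

End Excess.

Lemma card_ord_range K m : (m <= K)%N -> #|[set i : 'I_K.+1 | (0 < i <= m)%N]| = m.
Proof.
move=> hm; rewrite cardsE -sum1_card (eq_bigl (fun i : 'I_K.+1 => (0 < i <= m)%N)) //.
rewrite -(big_mkord (fun i => (0 < i <= m)%N) (fun=> 1%N)) big_ltn_cond //= big_mkcond /=.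
rewrite (big_cat_nat (n := m.+1)) //=.
rewrite (eq_big_nat _ _ (F2 := fun=> 1%N)); last by move=> i /andP[h1 h2]; rewrite h1 -ltnS h2.
rewrite sum_nat_const_nat subSS subn0 muln1 big_nat_cond big1 ?addn0 // => i.
by rewrite andbT => /andP[h _]; rewrite ifF //; lia.
Qed.

Section Parts.
Variable n : nat.

Lemma nseq_bseq (s : seq nat) : 0%N \notin s -> (sumn s <= n)%N ->
  exists b : n.-bseq 'I_n.+1, [seq val i | i <- b] = s.
Proof.
move=> s0 sn.
have hs : (size s <= n)%N.
  apply: leq_trans sn; elim: s s0 => //= a s IH; rewrite inE negb_or => /andP[ha h0].
  by have := IH h0; lia.
pose t : seq 'I_n.+1 := [seq inord k | k <- s].
have ht : (size t <= n)%N by rewrite size_map.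
exists (Bseq ht) => /=; rewrite /t -map_comp -[RHS]map_id; apply/eq_in_map => k ks /=.
by rewrite inordK // ltnS (leq_trans (leq_sumn ks) sn).
Qed.

Lemma exists_intpart (s : seq nat) : 0%N \notin s -> sumn s = n ->
  exists mu : intpart n, perm_eq mu s.
Proof.
move=> s0 sn; set u := sort geq s.
have us : perm_eq u s by rewrite /u perm_sort.
have u0 : 0%N \notin u by rewrite (perm_mem us).
have un : sumn u = n by rewrite (perm_sumn us).
have [b eb] := nseq_bseq u0 (eq_leq un).
have hb : is_intpart b.
  rewrite /is_intpart eb u0 un eqxx !andbT sort_sorted // => a c; exact: leq_total.
by exists (IntPart hb); rewrite /parts /= eb.
Qed.

Lemma intpart_props (mu : intpart n) : isort mu /\ sumn mu = n.
Proof.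
have [h1 h2 /eqP h3] := and3P (valP mu).
by rewrite /isort /parts h1 h2 h3.
Qed.

Lemma sumn_intpart (mu : intpart n) : sumn mu = n.
Proof. by case: (intpart_props mu). Qed.
Lemma isort_intpart (mu : intpart n) : isort mu.
Proof. by case: (intpart_props mu). Qed.
Lemma sorted_intpart (mu : intpart n) : sorted geq mu.
Proof. by case/andP: (isort_intpart mu). Qed.
Lemma intpart_n0 (mu : intpart n) : 0%N \notin (mu : seq nat).
Proof. by case/andP: (isort_intpart mu). Qed.

Lemma parts_inj : injective (@parts n).
Proof.
move=> mu nu; rewrite /parts => /(inj_map val_inj) e.
by apply/val_inj/val_inj.
Qed.

Lemma perm_parts (mu nu : intpart n) : perm_eq mu nu -> mu = nu.
Proof.
move=> e; apply: parts_inj; apply: dom_antisym; rewrite ?isort_intpart ?sumn_intpart //;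
 move=> t; rewrite ?(excess_perm t e) //.
Qed.

Lemma size_intpart (mu : intpart n) : (size mu <= n)%N.
Proof. by rewrite size_map size_bseq. Qed.

Lemma dominatedP (mu la : intpart n) : reflect (dom mu la) (dominated mu la).
Proof.
apply: (iffP forallP) => [H|H k]; last first.
  by apply: take_of_dom; rewrite ?sorted_intpart ?sumn_intpart.
apply: dom_of_take; rewrite ?sorted_intpart ?sumn_intpart // => k.
have [hk|hk] := ltnP k n.+1; first exact: (H (Ordinal hk)).
have := size_intpart mu; have := size_intpart la => h1 h2.
by rewrite !take_oversize ?sumn_intpart //; lia.
Qed.

Lemma dominated_refl (mu : intpart n) : dominated mu mu.
Proof. by apply/dominatedP => t. Qed.
Lemma dominated_trans (nu mu la : intpart n) : dominated mu nu -> dominated nu la -> dominated mu la.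
Proof. by move=> /dominatedP h1 /dominatedP h2; apply/dominatedP; exact: dom_trans h1 h2. Qed.
Lemma dominated_antisym (mu la : intpart n) : dominated mu la -> dominated la mu -> mu = la.
Proof.
move=> /dominatedP h1 /dominatedP h2; apply: parts_inj.
by apply: dom_antisym; rewrite ?isort_intpart ?sumn_intpart.
Qed.

(** A natural number that grows strictly along dominance, for inductions and maximal choices in this
    partial order. *)
Definition rank (mu : intpart n) := #|[pred nu | dominated nu mu]|.
Lemma rank_lt (mu la : intpart n) : dominated mu la -> mu != la -> (rank mu < rank la)%N.
Proof.
move=> h ne; apply: proper_card; apply/properP; split.
  by apply/subsetP => nu /=; rewrite !inE => h'; exact: dominated_trans h' h.
exists la; rewrite !inE ?dominated_refl //.
by apply: contraNN ne => h'; apply/eqP/dominated_antisym.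
Qed.

End Parts.

(** * Coefficients of power sum products *)

Section Coefficients.
Variables (R : realType) (n : nat).
Local Notation N := n.+1.
Implicit Types (f p q : {mpoly R[N]}) (b m : 'X_{1..N}) (j : 'I_N) (s : seq nat).

Definition upd b j u v : 'X_{1..N} :=
  [multinom (if i == ord0 then u else if i == j then v else b i) | i < N].

Lemma upd0 b j u v : upd b j u v ord0 = u.
Proof. by rewrite mnmE eqxx. Qed.
Lemma updj b j u v : j != ord0 -> upd b j u v j = v.
Proof. by rewrite mnmE eqxx => /negbTE ->. Qed.
Lemma upd_id b j : upd b j (b ord0) (b j) = b.
Proof. by apply/mnmP => i; rewrite mnmE; case: eqP => [->|_] //; case: eqP => [->|]. Qed.

Lemma mcoeffMXif p m b : (p * 'X_[m])@_b = if (m <= b)%MM then p@_(b - m) else 0.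
Proof.
case: ifP => h; first by rewrite -{1}(submK h) addmC mcoeffMX.
apply/eqP; rewrite mcoeff_eq0 (perm_mem (msuppMX p m)).
by apply/mapP => -[m' _ e]; rewrite e lem_addr in h.
Qed.

Definition powsum k : {mpoly R[N]} := \sum_(i < N) 'X_i ^+ k.
(** Indexed by arbitrary sequences, so that parts can be added and removed without sorting. *)
Definition powprod s : {mpoly R[N]} := \prod_(k <- s) powsum k.

Lemma powprod_cons k s : powprod (k :: s) = powsum k * powprod s.
Proof. by rewrite /powprod big_cons. Qed.

Lemma powprod_perm s u : perm_eq s u -> powprod s = powprod u.
Proof. exact: perm_big. Qed.

Lemma mulmn_le j k b : (U_(j) *+ k <= b)%MM = (k <= b j)%N.
Proof.
apply/mnm_lepP/idP => [/(_ j)|h i]; rewrite mulmnE mnm1E ?eqxx ?mul1n //.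
by case: eqP => [<-|_]; rewrite ?mul1n.
Qed.

Lemma mcoeff_powprod_cons k s b : (powprod (k :: s))@_b =
  \sum_(j < N) if (k <= b j)%N then (powprod s)@_(b - U_(j) *+ k) else 0.
Proof.
rewrite powprod_cons mulrC mulr_sumr raddf_sum; apply: eq_bigr => j _ /=.
by rewrite mpolyXn mcoeffMXif mulmn_le.
Qed.

Lemma powprod_nil_coeff b : (powprod [::])@_b = (b == 0%MM)%:R.
Proof. by rewrite /powprod big_nil mcoeff1. Qed.

Lemma powsum_sym k : powsum k \is symmetric.
Proof.
apply/issymP => s; rewrite /powsum raddf_sum /= [RHS](reindex_inj (@perm_inj _ s)) /=.
apply: eq_bigr => i _; rewrite rmorphXn /= msymX; congr ('X_[_] ^+ _).
apply/mnmP => l; rewrite !mnmE; congr nat_of_bool.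
by apply/eqP/eqP => [->|<-]; rewrite ?permKV ?permK.
Qed.

Lemma powprod_sym s : powprod s \is symmetric.
Proof. by apply: rpred_prod => k _; exact: powsum_sym. Qed.

Lemma sym_upd f b j u v : j != ord0 -> f \is symmetric ->
  f@_(upd b j u v) = f@_(upd b j v u).
Proof.
move=> j0 fs; rewrite -(msym_coeff _ (tperm ord0 j) fs); congr (_@__).
apply/mnmP => i; rewrite !mnmE; case: tpermP => [->|->|/eqP h1 /eqP h2].
- by rewrite (negbTE j0) !eqxx.
- by rewrite (negbTE j0) !eqxx.
- by rewrite (negbTE h1) (negbTE h2).
Qed.

(* The Cherednik-type operator $\alpha x_0\partial_0 + \sum_{j \ne 0} \frac{x_j}{x_0 - x_j}(1 - s_{0j})$
   read on coefficients, with the cancellations between the two exponents carried out. *)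
Definition exch (F : 'X_{1..N} -> R) j b : R :=
  (if (b ord0 < b j)%N then F (upd b j (b j) (b ord0)) - F b else 0) +
  \sum_(i < minn (b ord0) (b j))
    (F (upd b j (b ord0 + b j - i) i) - F (upd b j i (b ord0 + b j - i))).

Definition cherednik (al : R) (F : 'X_{1..N} -> R) b : R :=
  al * (b ord0)%:R * F b + \sum_(j < N | j != ord0) exch F j b.

(** The summand is antisymmetric under i -> b_0 + b_j - i, so the indices between the two exponents
    cancel in pairs. The resulting range depends on b_0 alone. *)
Lemma exchE F j b : j != ord0 -> exch F j b =
  \sum_(i < (b ord0).+1)
    (F (upd b j (b ord0 + b j - i) i) - F (upd b j i (b ord0 + b j - i))).
Proof.
move=> j0; rewrite /exch; set r := b ord0; set s := b j.
pose G i := F (upd b j (r + s - i) i) - F (upd b j i (r + s - i)).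
rewrite -(big_mkord xpredT G) -[RHS](big_mkord xpredT G).
case: ltnP => h.
  rewrite big_nat_recr //= addrC; congr (_ + _).
  by rewrite /G addKn upd_id.
rewrite add0r [RHS](big_cat_nat (n := s)) //=; last exact: leq_trans h (leqnSn _).
rewrite -[LHS]addr0; congr (_ + _).
have e : \sum_(s <= i < r.+1) F (upd b j (r + s - i) i) =
         \sum_(s <= i < r.+1) F (upd b j i (r + s - i)).
  rewrite big_nat_rev /=; apply: eq_big_nat => i hi.
  by congr (F (upd b j _ _)); lia.
by rewrite sumrB e subrr.
Qed.

(** Telescoping with step [a]: the coefficient form of writing (x_0^a - x_j^a)/(x_0 - x_j) as a
    geometric sum. *)
Lemma sum_window (psi : nat -> R) a r :
  \sum_(i < r.+1) (psi i - (if (a <= i)%N then psi (i - a)%N else 0)) =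
  \sum_(t < a) (if (t <= r)%N then psi (r - t)%N else 0).
Proof.
elim: r => [|r IH].
  rewrite big_ord1; case: a => [|a]; first by rewrite big_ord0 subrr.
  by rewrite big_ord_recl /= subr0 big1 ?addr0.
rewrite big_ord_recr IH /=.
set g := fun t => if (t <= r.+1)%N then psi (r.+1 - t)%N else 0.
rewrite -[RHS](big_mkord xpredT g).
rewrite -(big_mkord xpredT (fun t => if (t <= r)%N then psi (r - t)%N else 0)).
have -> : \sum_(0 <= t < a) (if (t <= r)%N then psi (r - t)%N else 0) =
          \sum_(1 <= t < a.+1) g t by rewrite big_add1.
have e : \sum_(0 <= t < a.+1) g t = g 0%N + \sum_(1 <= t < a.+1) g t by rewrite big_ltn.
rewrite big_nat_recr //= in e.
have -> : psi r.+1 = g 0%N by rewrite /g subn0.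
by rewrite -/(g a) addrA [_ + g 0%N]addrC -e addrK.
Qed.

(** A symmetric [f] passes through the exchange, which therefore acts on x_0^a only and yields x_j
    (x_0^a - x_j^a)/(x_0 - x_j). *)
Lemma exch_mulX f j b a : j != ord0 -> f \is symmetric ->
  exch (fun b => (f * 'X_ord0 ^+ a)@_b) j b =
  (f * \sum_(t < a) 'X_ord0 ^+ t * 'X_j ^+ (a - t))@_b.
Proof.
move=> j0 fs; rewrite exchE //; set r := b ord0; set s := b j.
(* The coefficient of [f] at exponents i and r + s - a - i of x_0 and x_j; the guard gives 0 where
   the subtraction would truncate. *)
pose psi i := if (i + a <= r + s)%N then f@_(upd b j i (r + s - a - i)) else 0.
transitivity (\sum_(i < r.+1) (psi i - (if (a <= i)%N then psi (i - a)%N else 0))).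
  apply: eq_bigr => i _; have hi := ltn_ord i.
  rewrite !mpolyXn !mcoeffMXif !mulmn_le !upd0; congr (_ - _).
    rewrite /psi; have -> : (a <= r + s - i)%N = (i + a <= r + s)%N by lia.
    case: ifP => // h; rewrite sym_upd //; congr (_@__); apply/mnmP => l.
    rewrite !mnmE mulmnE mnm1E; case: eqP => [->|/eqP l0]; first by rewrite eqxx; lia.
    by rewrite [ord0 == l]eq_sym (negbTE l0); case: eqP; rewrite ?subn0.
  case: ifP => // h; rewrite /psi subnK //.
  have -> : (i <= r + s)%N by lia.
  congr (_@__); apply/mnmP => l.
  rewrite !mnmE mulmnE mnm1E; case: eqP => [->|/eqP l0]; first by rewrite eqxx; lia.
  by rewrite [ord0 == l]eq_sym (negbTE l0); case: eqP; rewrite ?subn0 //; lia.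
rewrite sum_window mulr_sumr raddf_sum /=; apply: eq_bigr => t _; have ht := ltn_ord t.
rewrite !mpolyXn -mpolyXD mcoeffMXif.
have -> : (U_(ord0) *+ t + U_(j) *+ (a - t) <= b)%MM = (t <= r)%N && (a - t <= s)%N.
  apply/mnm_lepP/andP => [h|[h1 h2] l].
    have := h ord0; have := h j; rewrite !mnmDE !mulmnE !mnm1E !eqxx.
    by rewrite [ord0 == j]eq_sym (negbTE j0) -/r -/s; lia.
  rewrite !mnmDE !mulmnE !mnm1E; have [e|l0] := eqVneq ord0 l.
    by rewrite -e (negbTE j0) -/r; lia.
  by have [e|_] := eqVneq j l; rewrite -?e -/s; lia.
case: leqP => //= h; rewrite /psi.
have -> : (r - t + a <= r + s)%N = (a - t <= s)%N by lia.
case: ifP => // h2; congr (_@__); apply/mnmP => l.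
rewrite !mnmE !mulmnE !mnm1E; case: eqP => [->|/eqP l0].
  by rewrite eqxx (negbTE j0) -/r; lia.
rewrite [ord0 == l]eq_sym (negbTE l0) [j == l]eq_sym; case: eqP => [->|_]; rewrite -/s; lia.
Qed.

Definition wpow a s : {mpoly R[N]} := powprod s * 'X_ord0 ^+ a.

Definition euler p : {mpoly R[N]} := 'X_ord0 * p^`M(ord0).

Lemma euler_coeff p b : (euler p)@_b = (b ord0)%:R * p@_b.
Proof.
rewrite /euler mulrC -['X_ord0]expr1 mpolyXn mcoeffMXif mulmn_le.
rewrite mcoeff_deriv; case: ltnP => h; last first.
  by rewrite (_ : b ord0 = 0%N) ?mul0r //; lia.
rewrite mulm1n submK ?lep1mP -?lt0n //.
by rewrite mnmBE mnm1E eqxx subn1 prednK // -[LHS]mulr_natl.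
Qed.

Lemma eulerM p q : euler (p * q) = euler p * q + p * euler q.
Proof. rewrite /euler mderivM; ring. Qed.

Lemma euler_X0 a : euler ('X_ord0 ^+ a) = a%:R *: 'X_ord0 ^+ a.
Proof.
apply/mpolyP => b; rewrite euler_coeff mcoeffZ mpolyXn mcoeffX.
by case: eqP => [<-|_]; rewrite ?mulr0 // mulmnE mnm1E eqxx mul1n.
Qed.

Lemma euler_powsum k : euler (powsum k) = k%:R *: 'X_ord0 ^+ k.
Proof.
apply/mpolyP => b; rewrite euler_coeff mcoeffZ /powsum raddf_sum (bigD1 ord0) //=.
rewrite mulrDr big_distrr /= big1 ?addr0 => [|i i0]; rewrite !mpolyXn !mcoeffX.
  by case: eqP => [<-|_]; rewrite ?mulr0 // mulmnE mnm1E eqxx mul1n.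
case: eqP => [<-|_]; rewrite ?mulr0 //.
by rewrite mulmnE mnm1E (negbTE i0) mul0n mul0r.
Qed.

Lemma euler_powprod s : euler (powprod s) =
  \sum_(k <- s) k%:R *: (powprod (rem k s) * 'X_ord0 ^+ k).
Proof.
elim: s => [|a s IH].
  apply/mpolyP => b; rewrite euler_coeff powprod_nil_coeff big_nil mcoeff0.
  by case: eqP => [->|]; rewrite ?mulr0 // mnm0E mul0r.
rewrite powprod_cons eulerM euler_powsum IH big_cons /= eqxx; congr (_ + _).
  by rewrite -scalerAl mulrC.
rewrite mulr_sumr !big_seq; apply: eq_bigr => k ks.
rewrite -scalerAr mulrA -powprod_cons; congr (_ *: (_ * _)).
apply: powprod_perm; case: eqP => [->|] //.
by rewrite perm_sym perm_to_rem.
Qed.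

(** The geometric sums over j != 0 lack only the term of x_0 to become power sums. Adding it costs
    x_0^a for each of the [a] values of t, which turns the diagonal factor [al] of the Euler
    operator into [al - 1]. *)
Lemma cherednik_wpow al a s b :
  cherednik al (fun b => (wpow a s)@_b) b =
  ((al - 1) * a%:R) * (wpow a s)@_b
   + \sum_(t < a) (wpow t ((a - t)%N :: s))@_b
   + \sum_(k <- s) al * k%:R * (wpow (a + k) (rem k s))@_b.
Proof.
rewrite /cherednik -mulrA -euler_coeff {1}/wpow eulerM euler_powprod euler_X0.
rewrite (eq_bigr _ (fun j hj => exch_mulX b a hj (powprod_sym s))) /=.
rewrite -raddf_sum -mulr_sumr /=.
have -> : \sum_(j < N | j != ord0) \sum_(t < a) 'X_ord0 ^+ t * 'X_j ^+ (a - t) =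
   \sum_(t < a) 'X_ord0 ^+ t * powsum (a - t) - a%:R *: ('X_ord0 ^+ a : {mpoly R[N]}).
  rewrite exchange_big /= [X in _ = _ - X](_ : _ = \sum_(t < a) 'X_ord0 ^+ a); last first.
    by rewrite sumr_const card_ord scaler_nat.
  rewrite -sumrB; apply: eq_bigr => t _.
  rewrite /powsum (bigD1 (P := xpredT) ord0) //= mulrDr -exprD subnKC; last exact: ltnW.
  by rewrite [X in X - _]addrC addrK mulr_sumr.
rewrite mulrBr mulr_sumr mulr_suml !mcoeffD mcoeffN !raddf_sum /=.
rewrite -!scalerAr !mcoeffZ mulrDr mulr_sumr -/(wpow a s).
have -> : \sum_(k <- s) al * ((k%:R *: (powprod (rem k s) * 'X_ord0 ^+ k)) * 'X_ord0 ^+ a)@_b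
   = \sum_(k <- s) al * k%:R * (wpow (a + k) (rem k s))@_b.
  by apply: eq_bigr => k _; rewrite -scalerAl mcoeffZ mulrA /wpow -[powprod _ * _ * _]mulrA -exprD addnC.
have -> : \sum_(i < a) (powprod s * ('X_ord0 ^+ i * powsum (a - i)))@_b =
  \sum_(t < a) (wpow t ((a - t)%N :: s))@_b.
  by apply: eq_bigr => t _; rewrite /wpow powprod_cons; congr (_@__); ring.
ring.
Qed.

End Coefficients.

(** * Supports and hook-shaped monomials *)

Section Supports.
Variables (R : realType) (n : nat).
Local Notation N := n.+1.
Implicit Types (b : 'X_{1..N}) (j : 'I_N) (s : seq nat).

Definition nz b : seq nat := [seq k <- b | k != 0%N].

Lemma mnm_seqE b : (b : seq nat) = [seq b i | i <- enum 'I_N].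
Proof. by rewrite [RHS]map_tnth_enum. Qed.

Lemma perm_mnm1 b j : perm_eq b (b j :: [seq b i | i <- rem j (enum 'I_N)]).
Proof.
rewrite mnm_seqE -(map_cons (fun_of_multinom b)); apply: perm_map.
by apply: perm_to_rem; rewrite mem_enum.
Qed.

Lemma perm_mnm1_eq b b' j : (forall i, i != j -> b i = b' i) ->
  exists r, perm_eq b (b j :: r) /\ perm_eq b' (b' j :: r).
Proof.
move=> h; exists [seq b i | i <- rem j (enum 'I_N)]; split; first exact: perm_mnm1.
rewrite (_ : [seq b i | i <- _] = [seq b' i | i <- rem j (enum 'I_N)]) ?perm_mnm1 //.
apply/eq_in_map => i; rewrite mem_rem_uniq ?enum_uniq // inE => /andP[ij _]; exact: h.
Qed.

Lemma perm_mnm2_eq b b' j : j != ord0 -> (forall i, i != j -> i != ord0 -> b i = b' i) ->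
  exists r, perm_eq b [:: b ord0, b j & r] /\ perm_eq b' [:: b' ord0, b' j & r].
Proof.
move=> j0 h; set l := rem j (rem ord0 (enum 'I_N)).
have e (c : 'X_{1..N}) : perm_eq c [:: c ord0, c j & [seq c i | i <- l]].
  apply: perm_trans (perm_mnm1 c ord0) _; rewrite perm_cons -(map_cons (fun_of_multinom c)).
  apply: perm_map; apply: perm_to_rem.
  by rewrite mem_rem_uniq ?enum_uniq // inE j0 mem_enum.
exists [seq b i | i <- l]; split; first exact: e.
rewrite (_ : [seq b i | i <- _] = [seq b' i | i <- l]) ?e //.
apply/eq_in_map => i; rewrite !mem_rem_uniq ?rem_uniq ?enum_uniq // !inE.
by rewrite mem_rem_uniq ?enum_uniq // inE => /andP[ij /andP[i0 _]]; exact: h.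
Qed.

Lemma perm_nz b u : perm_eq b u -> perm_eq (nz b) [seq k <- u | k != 0%N].
Proof. exact: perm_filter. Qed.

Lemma nz_n0 b : 0%N \notin nz b.
Proof. by rewrite mem_filter. Qed.

Lemma excess_mnm t b : excess t (nz b) = excess t b.
Proof. exact: excess_nz. Qed.

Lemma sumn_nz b : sumn (nz b) = mdeg b.
Proof.
rewrite /mdeg /nz sumnE big_filter [RHS](bigID (fun k => k != 0%N)) /=.
by rewrite [X in _ = (_ + X)%N]big1 ?addn0 // => k /negPn/eqP.
Qed.

Lemma subU_off b j k : forall i, i != j -> b i = (b - U_(j) *+ k)%MM i.
Proof. by move=> i ij; rewrite mnmBE mulmnE mnm1E eq_sym (negbTE ij) subn0. Qed.
Lemma subU_at b j k : (b - U_(j) *+ k)%MM j = (b j - k)%N.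
Proof. by rewrite mnmBE mulmnE mnm1E eqxx mul1n. Qed.

Lemma powprod_coeff_ge0 s b : 0 <= (powprod R n s)@_b.
Proof.
elim: s b => [|k s IH] b; first by rewrite powprod_nil_coeff ler0n.
by rewrite mcoeff_powprod_cons; apply: sumr_ge0 => j _; case: ifP.
Qed.

(** Each exponent of a monomial of p_s is a sum of parts of [s]; with at least [size s] nonzero
    exponents no two parts can have been merged. *)
Lemma powprod_coeff_neq0 s b : 0%N \notin s -> (size s <= size (nz b))%N ->
  (powprod R n s)@_b != 0 -> perm_eq s (nz b).
Proof.
elim: s b => [|k s IH] b.
  move=> _ _; rewrite powprod_nil_coeff; case: (b =P 0%MM) => [-> _|]; last by rewrite eqxx.
  rewrite /nz (_ : filter _ _ = [::]) // -(filter_pred0 (0%MM : 'X_{1..N})).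
  by apply: eq_in_filter => x /tnthP[i ->]; rewrite -/(fun_of_multinom _ i) mnm0E.
rewrite inE negb_or => /andP[k0 s0] hs; rewrite mcoeff_powprod_cons => hne.
have /existsP[j /andP[kj hj]] : [exists j, (k <= b j)%N && ((powprod R n s)@_(b - U_(j) *+ k) != 0)].
  apply: contraNT hne => /existsPn H; rewrite big1 // => j _.
  by have := H j; case: ifP => //= _ /negPn/eqP.
have [r [h1 h2]] := perm_mnm1_eq (@subU_off b j k).
have bj : b j != 0%N by lia.
have := perm_nz h1; rewrite /= bj => p1.
have := perm_nz h2; rewrite subU_at /= => p2.
have e1 := perm_size p1; have e2 := perm_size p2; rewrite /= in e1.
have hp : perm_eq s (nz (b - U_(j) *+ k)).
  by apply: IH => //; rewrite e2; move: hs; rewrite e1 /= ; case: ifP => _ /=; lia.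
have e3 := perm_size hp; move: e2 p2; case: ifP => [h|/negbFE/eqP h] e2 p2.
  by move: hs; rewrite /= e1 e3 e2 /=; lia.
have -> : k = b j by lia.
rewrite perm_sym; apply: perm_trans p1 _; rewrite perm_cons perm_sym.
exact: perm_trans hp p2.
Qed.

Lemma powprod_coeff_gt0 s b : perm_eq s (nz b) -> 0 < (powprod R n s)@_b.
Proof.
elim: s b => [|k s IH] b hp.
  rewrite powprod_nil_coeff (_ : b = 0%MM) ?eqxx ?ltr01 //.
  by apply/eqP; rewrite -mdeg_eq0 -sumn_nz -(perm_sumn hp).
have : k \in nz b by rewrite -(perm_mem hp) inE eqxx.
rewrite mem_filter => /andP[k0 /tnthP[j ej]]; rewrite -/(fun_of_multinom b j) in ej.
rewrite mcoeff_powprod_cons (bigD1 j) //= -ej leqnn ltr_pwDl //; last first.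
  by apply: sumr_ge0 => i _; case: ifP => // _; exact: powprod_coeff_ge0.
apply: IH; have [r [h1 h2]] := perm_mnm1_eq (@subU_off b j k).
have := perm_nz h1; rewrite /= -ej k0 => p1.
have := perm_nz h2; rewrite subU_at /= ej subnn /= => p2.
rewrite perm_sym; apply: perm_trans p2 _; rewrite -(perm_cons k) perm_sym.
exact: perm_trans hp p1.
Qed.

(** The exponent of x_0 is kept at 0, so that these monomials detect only the elements x_0^a p_nu
    with a = 0. *)
Definition emb s : 'X_{1..N} := [multinom nth 0%N (0%N :: s) i | i < N].

Lemma emb0 s : emb s ord0 = 0%N. Proof. by rewrite mnmE. Qed.

Lemma nz_emb s : 0%N \notin s -> (size s <= n)%N -> nz (emb s) = s.
Proof.
move=> s0 hs.
rewrite /nz mnm_seqE (eq_map (g := fun i : 'I_N => nth 0%N (0%N :: s) i)); last by move=> i; rewrite mnmE.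
rewrite (map_comp (nth 0%N (0%N :: s)) val) val_enum_ord /= -(subnKC hs).
rewrite -[1%N]addn0 iotaDl -map_comp iotaD map_cat filter_cat add0n.
rewrite (_ : map _ (iota (size s) _) = nseq (n - size s) 0%N); last first.
  apply: (@eq_from_nth _ 0%N) => [|i]; rewrite size_map size_iota ?size_nseq // => hi.
  by rewrite (nth_map 0%N) ?size_iota // nth_iota // nth_nseq hi /= nth_default // leq_addr.
rewrite [X in _ ++ X](_ : _ = [::]) ?cats0; last by elim: (n - size s)%N.
rewrite (_ : map _ _ = s); last by rewrite -[RHS](mkseq_nth 0%N s).
by apply/all_filterP/allP => x xs; apply: contraNneq s0 => <-.
Qed.

(** Among the indices with [f t != 0] take one of maximal length: by [powprod_coeff_neq0] no other
    one contributes to its monomial. Testing exponents with b_0 = 0 only is what lets [expand_free]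
    strip powers of x_0. *)
Lemma powprod_free (T : finType) (pt : T -> seq nat) (f : T -> R) :
  (forall t, 0%N \notin pt t) -> (forall t, size (pt t) <= n)%N ->
  (forall t u, perm_eq (pt t) (pt u) -> t = u) ->
  (forall b, b ord0 = 0%N -> \sum_t f t * (powprod R n (pt t))@_b = 0) ->
  forall t, f t = 0.
Proof.
move=> pt0 ptn pt_inj H t0; apply/eqP; apply: contraT => f0.
have [t ft ht] := @arg_maxnP _ t0 (fun t => f t != 0) (fun t => size (pt t)) f0.
have enz : nz (emb (pt t)) = pt t by rewrite nz_emb ?pt0 ?ptn.
have := H (emb (pt t)) (emb0 _); rewrite (bigD1 t) //= big1 ?addr0 => [|u ne].
  move/eqP; rewrite mulf_eq0 (negbTE ft) /= => /eqP e0.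
  by have := powprod_coeff_gt0 (s := pt t) (b := emb (pt t)); rewrite e0 enz perm_refl ltxx => /(_ isT).
have [->|fu] := eqVneq (f u) 0; first by rewrite mul0r.
apply/eqP; apply: contraNT ne; rewrite mulf_eq0 (negbTE fu) /= => hne.
apply/eqP/pt_inj; rewrite -[X in perm_eq _ X]enz; apply: powprod_coeff_neq0 => //.
by rewrite enz; exact: ht.
Qed.

Lemma powprod_homog s b : (powprod R n s)@_b != 0 -> mdeg b = sumn s.
Proof.
elim: s b => [|k s IH] b.
  by rewrite powprod_nil_coeff; case: (b =P 0%MM) => [->|]; rewrite ?mdeg0 // eqxx.
rewrite mcoeff_powprod_cons => hne.
have /existsP[j /andP[kj hj]] : [exists j, (k <= b j)%N && ((powprod R n s)@_(b - U_(j) *+ k) != 0)].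
  apply: contraNT hne => /existsPn H; rewrite big1 // => j _.
  by have := H j; case: ifP => //= _ /negPn/eqP.
have e := IH _ hj; have hle : (U_(j) *+ k <= b)%MM by rewrite mulmn_le.
by rewrite -(submK hle) mdegD e mdegMn mdeg1 mul1n addnC.
Qed.

Lemma wpow_homog a s b : (wpow R n a s)@_b != 0 -> mdeg b = (a + sumn s)%N.
Proof.
rewrite /wpow mpolyXn mcoeffMXif mulmn_le; case: leqP => h; last by rewrite eqxx.
move=> /powprod_homog e; have hle : (U_(ord0) *+ a <= b)%MM by rewrite mulmn_le.
by rewrite -(submK hle) mdegD e mdegMn mdeg1 mul1n addnC.
Qed.

Lemma monsym_coeff (mu : intpart n) b : (monsym R N mu)@_b = (perm_eq (nz b) mu)%:R.
Proof.
rewrite /monsym raddf_sum /=; case: (ltnP (mdeg b) n.+1) => hb; last first.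
  rewrite big1 => [|a _].
    case: (boolP (perm_eq _ _)) => // /perm_sumn; rewrite sumn_nz sumn_intpart; lia.
  rewrite mcoeffX; case: eqP => // e; have := bmdeg a; rewrite e; lia.
case: (boolP (perm_eq (nz b) mu)) => hp.
  rewrite (bigD1 (BMultinom hb)) //= mcoeffX eqxx big1 ?addr0 // => a /andP[_ ab].
  by rewrite mcoeffX; case: eqP => // e; case/eqP: ab; apply/val_inj.
rewrite big1 // => a ha; rewrite mcoeffX; case: eqP => // e.
by rewrite -e /nz ha in hp.
Qed.

Lemma expansion_coeff (f : Defs.symf R n) (c : intpart n -> R) b : monomial_expansion f c ->
  (\sum_mu f mu *: powprod R n mu)@_b = \sum_(mu : intpart n) c mu * (perm_eq (nz b) mu)%:R.
Proof.
move=> /(_ N); rewrite /symf_eval => ->; rewrite raddf_sum /=.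
by apply: eq_bigr => mu _; rewrite mcoeffZ monsym_coeff.
Qed.

Definition hook r (A : {set 'I_N}) : 'X_{1..N} :=
  [multinom (if i == ord0 then r else (i \in A : nat)) | i < N].

Lemma hook0 r A : hook r A ord0 = r. Proof. by rewrite mnmE eqxx. Qed.
Lemma hookj r (A : {set 'I_N}) j : j != ord0 -> hook r A j = (j \in A).
Proof. by rewrite mnmE => /negbTE ->. Qed.

Lemma hook_sub0 r A k : (hook r A - U_(ord0) *+ k)%MM = hook (r - k) A.
Proof.
apply/mnmP => i; rewrite mnmBE mulmnE mnm1E !mnmE [ord0 == i]eq_sym.
by case: eqP => _; rewrite ?mul1n ?subn0.
Qed.

Lemma hook_subj r (A : {set 'I_N}) j : j != ord0 -> j \in A ->
  (hook r A - U_(j) *+ 1)%MM = hook r (A :\ j).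
Proof.
move=> j0 jA; apply/mnmP => i; rewrite mnmBE mulmnE mnm1E !mnmE !inE.
case: eqP => [->|_]; first by rewrite (negbTE j0) subn0.
by rewrite [i == j]eq_sym; case: eqP => [<-|_] /=; rewrite ?jA ?subn0 // muln1.
Qed.

Lemma count1_sumn s : 0%N \notin s -> (count_mem 1%N s <= sumn s)%N.
Proof.
elim: s => //= a s IH; rewrite inE negb_or => /andP[a0 h].
by have := IH h; case: eqP; lia.
Qed.

(** Each variable of [A] must receive exactly one part, equal to 1, and all other parts go to x_0;
    the falling factorial counts these choices. *)
Lemma powprod_hook s r (A : {set 'I_N}) : 0%N \notin s -> ord0 \notin A ->
  (r + #|A| = sumn s)%N -> (powprod R n s)@_(hook r A) = (count_mem 1%N s ^_ #|A|)%:R.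
Proof.
elim: s r A => [|k s IH] r A /=.
  move=> _ A0 /eqP; rewrite addn_eq0 => /andP[/eqP -> /eqP/cards0_eq eA].
  rewrite powprod_nil_coeff eA cards0 ffactn0 (_ : _ == _ = true) //.
  by apply/eqP/mnmP => i; rewrite !mnmE in_set0; case: eqP.
rewrite inE negb_or => /andP[k0 s0] A0 hs; rewrite mcoeff_powprod_cons (bigD1 ord0) //= hook0.
have c1 := count1_sumn s0.
rewrite hook_sub0 (_ : (if _ then _ else _) = (count_mem 1%N s ^_ #|A|)%:R); last first.
  case: leqP => h; first by rewrite IH // addnBAC // hs addKn.
  by rewrite ffact_small // (leq_ltn_trans c1) // -(ltn_add2l r) hs ltn_add2r.
rewrite (eq_bigr (fun j => if (k == 1%N) && (j \in A) then (count_mem 1%N s ^_ (#|A|.-1))%:R else 0)); last first.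
  move=> j j0; rewrite hookj //.
  have [k1|k1] := eqVneq k 1%N; last by rewrite /= ifF //; apply/negbTE; move: k0 k1; case: (j \in A) => /=; lia.
  rewrite k1 /=; case jA: (j \in A) => //=.
  rewrite hook_subj // IH ?in_setD1 ?(negbTE A0) ?andbF //.
    by rewrite [#|A|](cardsD1 j) jA.
  by apply: (@addnI 1%N); rewrite -k1 -hs (cardsD1 j A) jA k1 addnCA.
have [k1|k1] := eqVneq k 1%N; last by rewrite big1 ?addr0 ?add0n.
rewrite -big_mkcondr /= sumr_const.
have -> : #|[pred i : 'I_N | (i != ord0) && (i \in A)]| = #|A|.
  apply: eq_card => i; rewrite !inE; case: eqP => // ->; by rewrite (negbTE A0).
rewrite -mulrnA -natrD addnC; congr _%:R; case: #|A| => [|a] /=; first by rewrite muln0.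
rewrite ffactnSr add1n ffactSS; have [ac|ac] := leqP a (count_mem 1%N s); last by rewrite ffact_small ?mul0n ?muln0.
by rewrite -mulnDr mulnC addSn subnKC.
Qed.

End Supports.

(** * The Lax operator *)

Section Lax.
Variables (R : realType) (n : nat) (al : R).
Local Notation N := n.+1.
Implicit Types (b : 'X_{1..N}) (j : 'I_N).

(* The partitions of size at most n; such a nu stands for the basis element
   x_0^(n - |nu|) p_nu of the symmetric functions with an extra variable. *)
Definition is_subpart (s : n.-bseq 'I_n.+1) : bool :=
  let t := [seq val i | i <- s] in [&& sorted geq t, 0%N \notin t & sumn t <= n]%N.
Definition subpart : finType := {s : n.-bseq 'I_n.+1 | is_subpart s}.
Definition sparts (nu : subpart) : seq nat := [seq val i | i <- val nu].
Implicit Types (mu nu : subpart).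

Lemma sparts_props nu : [&& sorted geq (sparts nu), 0%N \notin sparts nu & sumn (sparts nu) <= n]%N.
Proof. exact: (valP nu). Qed.
Lemma sparts_n0 nu : 0%N \notin sparts nu.
Proof. by case/and3P: (sparts_props nu). Qed.
Lemma sparts_sum nu : (sumn (sparts nu) <= n)%N.
Proof. by case/and3P: (sparts_props nu). Qed.
Lemma sparts_size nu : (size (sparts nu) <= n)%N.
Proof. by rewrite size_map size_bseq. Qed.
Lemma sparts_perm mu nu : perm_eq (sparts mu) (sparts nu) -> mu = nu.
Proof.
have [/and3P[h1 h2 _] /and3P[h3 h4 _]] := (sparts_props mu, sparts_props nu).
move=> e; apply/val_inj/val_inj/(inj_map val_inj); apply: dom_antisym.
- by rewrite /isort h1.
- by rewrite /isort h3.
- exact: perm_sumn.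
- by move=> t; rewrite -/(sparts mu) -/(sparts nu) (excess_perm t e).
- by move=> t; rewrite -/(sparts mu) -/(sparts nu) (excess_perm t e).
Qed.

Lemma exists_subpart (s : seq nat) : 0%N \notin s -> (sumn s <= n)%N ->
  exists nu : subpart, perm_eq (sparts nu) s.
Proof.
move=> s0 sn; set u := sort geq s.
have us : perm_eq u s by rewrite /u perm_sort.
have u0 : 0%N \notin u by rewrite (perm_mem us).
have un : (sumn u <= n)%N by rewrite (perm_sumn us).
have [b eb] := nseq_bseq u0 un.
have hb : is_subpart b.
  by rewrite /is_subpart eb u0 un !andbT sort_sorted // => a c; exact: leq_total.
by exists (exist _ b hb); rewrite /sparts /= eb.
Qed.

Definition zfactor (s : seq nat) : nat :=
  (\prod_(1 <= i < n.+1) (i ^ count_mem i s * (count_mem i s)`!))%N.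
(** The squared norms of the Jack inner product, extended to the basis x_0^a p_nu with powers of x_0
    of norm 1. *)
Definition weight (s : seq nat) : R := al ^+ size s * (zfactor s)%:R.

Lemma weight_perm s u : perm_eq s u -> weight s = weight u.
Proof.
move=> e; rewrite /weight (perm_size e); congr (_ * _%:R); apply: eq_bigr => i _.
by rewrite (seq.permP e).
Qed.

Lemma weight_cons k s : (0 < k <= n)%N ->
  weight (k :: s) = weight s * (al * k%:R * (count_mem k s).+1%:R).
Proof.
move=> /andP[k0 kn]; rewrite /weight /= exprS.
suff -> : zfactor (k :: s) = (zfactor s * (k * (count_mem k s).+1))%N.
  rewrite !natrM; ring.
have ki : k \in index_iota 1 n.+1 by rewrite mem_index_iota k0.
rewrite /zfactor !(bigD1_seq k ki (iota_uniq _ _)) /= eqxx add1n expnS factS.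
rewrite [X in (_ * X = _)%N](eq_bigr (fun i => (i ^ count_mem i s * (count_mem i s)`!)%N)); last first.
  by move=> i ik; rewrite [k == i]eq_sym (negbTE ik).
ring.
Qed.

(** Row [s], column [u] of the Nazarov-Sklyanin operator. The term with [k :: u] turns x_0^k into
    p_k; the term with [k :: s] turns one p_k into x_0^k, with the multiplicity coming from the
    derivative. *)
Definition lax (s u : seq nat) : R :=
  (s == u)%:R * ((al - 1) * (n - sumn u)%:R) +
  \sum_(1 <= k < n.+1) ((perm_eq s (k :: u))%:R +
    (perm_eq u (k :: s))%:R * (al * k%:R * (count_mem k u)%:R)).

(** Creating and removing a part k are adjoint: by [weight_cons] the ratio of the weights is exactly
    the entry al k m_k of the removal. *)
Lemma lax_sym s u : weight s * lax s u = weight u * lax u s.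
Proof.
rewrite /lax !mulrDr; congr (_ + _).
  by rewrite [u == s]eq_sym; case: eqP => [->|] //; rewrite !mul0r !mulr0.
rewrite !mulr_sumr !big_seq; apply: eq_bigr => k; rewrite mem_index_iota => kn.
rewrite addrC !mulrDr; congr (_ + _).
  case: (boolP (perm_eq u _)) => h; last by rewrite !mul0r !mulr0.
  by rewrite (weight_perm h) weight_cons // (seq.permP h) /= eqxx mulr1 mul1r.
case: (boolP (perm_eq s _)) => h; last by rewrite !mul0r !mulr0.
by rewrite (weight_perm h) weight_cons // (seq.permP h) /= eqxx mulr1 mul1r.
Qed.

Definition laxvec (s : seq nat) : {mpoly R[N]} := wpow R n (n - sumn s) s.

Lemma laxvec_perm s u : perm_eq s u -> laxvec s = laxvec u.
Proof. by move=> e; rewrite /laxvec /wpow (powprod_perm _ _ e) (perm_sumn e). Qed.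

Lemma sum_perm_subpart (F : seq nat -> R) s : 
  (forall s u, perm_eq s u -> F s = F u) -> 0%N \notin s ->
  \sum_(mu : subpart) (perm_eq (sparts mu) s)%:R * F (sparts mu) =
  if (sumn s <= n)%N then F s else 0.
Proof.
move=> Fp s0; case: ifP => sn.
  have [mu0 h0] := exists_subpart s0 sn.
  rewrite (bigD1 mu0) //= h0 mul1r (Fp _ _ h0) big1 ?addr0 // => mu ne.
  case: (boolP (perm_eq _ _)) => h; rewrite ?mul0r //; case/eqP: ne.
  by apply: sparts_perm; apply: perm_trans h _; rewrite perm_sym.
rewrite big1 // => mu _; case: (boolP (perm_eq _ _)) => h; rewrite ?mul0r //.
by have := sparts_sum mu; rewrite (perm_sumn h) sn.
Qed.

Lemma sum_count (F : nat -> R) s : 0%N \notin s -> (forall k, k \in s -> k <= n)%N ->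
  \sum_(1 <= k < n.+1) (count_mem k s)%:R * F k = \sum_(k <- s) F k.
Proof.
elim: s => [|a s IH]; first by rewrite big_nil big1 // => k _; rewrite mul0r.
rewrite inE negb_or => /andP[a0 s0] h.
rewrite big_cons -IH //; last by move=> k ks; apply: h; rewrite inE ks orbT.
have ai : a \in index_iota 1 n.+1 by rewrite mem_index_iota lt0n eq_sym a0 /= ltnS h ?inE ?eqxx.
rewrite (eq_bigr (fun k => (a == k)%:R * F k + (count_mem k s)%:R * F k)); last first.
  by move=> k _; rewrite /= natrD mulrDl.
rewrite big_split; congr (_ + _); rewrite (bigD1_seq a ai (iota_uniq _ _)) /= eqxx mul1r.
by rewrite big1 ?addr0 // => k ka; rewrite eq_sym (negbTE ka) mul0r.
Qed.

Lemma sumn_rem k s : k \in s -> (sumn (rem k s) + k = sumn s)%N.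
Proof. by move=> ks; rewrite (perm_sumn (perm_to_rem ks)) /= addnC. Qed.

(** The matrix form of [cherednik_wpow]. Sums over parts become sums over k from 1 to n: repeated
    parts turn into multiplicities, and creating k > a has no target because the size would exceed
    n. *)
Lemma lax_column nu b :
  \sum_(mu : subpart) lax (sparts mu) (sparts nu) * (laxvec (sparts mu))@_b =
  cherednik al (fun b => (laxvec (sparts nu))@_b) b.
Proof.
set s := sparts nu; have s0 := sparts_n0 nu; have sn := sparts_sum nu.
set a := (n - sumn s)%N.
pose F u := (laxvec u)@_b.
have Fp u v : perm_eq u v -> F u = F v by move=> e; rewrite /F (laxvec_perm e).
rewrite cherednik_wpow -/a -/(laxvec s) -/s.
transitivity ((al - 1) * a%:R * F s +
  \sum_(1 <= k < n.+1) (\sum_(mu : subpart) (perm_eq (sparts mu) (k :: s))%:R * F (sparts mu)) +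
  \sum_(1 <= k < n.+1) (count_mem k s)%:R * (al * k%:R *
      \sum_(mu : subpart) (perm_eq (k :: sparts mu) s)%:R * F (sparts mu))).
  rewrite -addrA -big_split /= /lax.
  rewrite (eq_bigr (fun mu => (sparts mu == s)%:R * ((al - 1) * (n - sumn s)%:R) * F (sparts mu) +
     (\sum_(1 <= k < n.+1) ((perm_eq (sparts mu) (k :: s))%:R * F (sparts mu) +
    (perm_eq s (k :: sparts mu))%:R * (al * k%:R * (count_mem k s)%:R) * F (sparts mu)))));
  last by move=> mu _; rewrite mulrDl mulr_suml; congr (_ + _); apply: eq_bigr => k _; rewrite mulrDl.
  rewrite big_split /=; congr (_ + _).
    rewrite (bigD1 nu) //= eqxx mul1r big1 ?addr0 // => mu ne.
    case: eqP => [e|]; rewrite ?mul0r //; case/eqP: ne; apply: sparts_perm; rewrite e; exact: perm_refl.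
  rewrite exchange_big /=; apply: eq_bigr => k _; rewrite big_split /=; congr (_ + _).
  rewrite !mulr_sumr; apply: eq_bigr => mu _; rewrite [perm_eq s _]perm_sym; ring.
congr (_ + _ + _).
  rewrite (eq_big_nat _ _ (F2 := fun k => if (k <= a)%N then (wpow R n (a - k) (k :: s))@_b else 0)).
    rewrite (big_cat_nat (n := a.+1)) //=; last by rewrite ltnS /a leq_subr.
    rewrite [X in _ + X]big_nat_cond [X in _ + X]big1 ?addr0; last first.
      by move=> k; rewrite andbT => /andP[h _]; rewrite ifF //; lia.
    rewrite big_add1 /= big_nat_rev /= big_mkord; apply: eq_bigr => t _.
    have ht := ltn_ord t; rewrite ifT; last lia.
    by congr ((wpow _ _ _ (_ :: _))@__); lia.
  move=> k /andP[k0 kn]; rewrite sum_perm_subpart //; last by rewrite inE negb_or s0 andbT; lia.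
  have -> : (sumn (k :: s) <= n)%N = (k <= a)%N by rewrite /= /a; lia.
  by rewrite /F /laxvec /=; case: ifP => // _; congr ((wpow _ _ _ _)@__); rewrite /a; lia.
rewrite (sum_count (fun k => al * k%:R * \sum_mu (perm_eq (k :: sparts mu) s)%:R * F (sparts mu)) s0); last first.
  by move=> k ks; apply: leq_trans (leq_sumn ks) sn.
rewrite !big_seq; apply: eq_bigr => k ks; congr (_ * _).
have r0 : 0%N \notin rem k s by apply: contra s0; exact: mem_rem.
rewrite (eq_bigr (fun mu => (perm_eq (sparts mu) (rem k s))%:R * F (sparts mu))); last first.
  move=> mu _; suff -> : perm_eq (k :: sparts mu) s = perm_eq (sparts mu) (rem k s) by [].
  rewrite -[RHS](perm_cons k).
  by apply/idP/idP => h; apply: perm_trans h _; rewrite ?perm_to_rem // perm_sym perm_to_rem.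
rewrite sum_perm_subpart //; have hr := sumn_rem ks.
rewrite ifT; last by rewrite (leq_trans _ sn) // -hr leq_addr.
rewrite /F /laxvec; congr ((wpow _ _ _ _)@__).
have e x y z : (x + k = y -> y <= z -> z - x = z - y + k)%N by lia.
exact: e hr sn.
Qed.

Definition laxop (z : subpart -> R) mu : R := \sum_nu lax (sparts mu) (sparts nu) * z nu.

Definition expand (z : subpart -> R) b : R := \sum_nu z nu * (laxvec (sparts nu))@_b.

Lemma cherednik_sum (I : finType) (z : I -> R) (F : I -> 'X_{1..N} -> R) b :
  cherednik al (fun b => \sum_i z i * F i b) b = \sum_i z i * cherednik al (F i) b.
Proof.
rewrite /cherednik.
rewrite [RHS](eq_bigr (fun i => al * (b ord0)%:R * (z i * F i b) +
   \sum_(j < N | j != ord0) z i * exch (F i) j b)); last first.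
  by move=> i _; rewrite mulrDr mulr_sumr; congr (_ + _); ring.
rewrite [RHS]big_split /= mulr_sumr; congr (_ + _); rewrite exchange_big /=.
apply: eq_bigr => j _; rewrite /exch.
rewrite [RHS](eq_bigr (fun i => (if (b ord0 < b j)%N then z i * F i (upd b j (b j) (b ord0)) - z i * F i b else 0) +
  \sum_(k < minn (b ord0) (b j)) (z i * F i (upd b j (b ord0 + b j - k) k) - z i * F i (upd b j k (b ord0 + b j - k))))).
  rewrite [RHS]big_split /=; congr (_ + _); last first.
    by rewrite [RHS]exchange_big /=; apply: eq_bigr => k _; rewrite -sumrB.
  by case: ifP => _; rewrite ?sumrB // big1.
move=> i _; rewrite mulrDr mulr_sumr; congr (_ + _).
  by case: ifP; rewrite ?mulr0 // mulrBr.
by apply: eq_bigr => k _; rewrite mulrBr.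
Qed.

Lemma expand_laxop z b : expand (laxop z) b = cherednik al (expand z) b.
Proof.
rewrite /expand cherednik_sum /laxop.
rewrite (eq_bigr (fun mu => \sum_nu z nu * (lax (sparts mu) (sparts nu) * (laxvec (sparts mu))@_b))).
  by rewrite exchange_big /=; apply: eq_bigr => nu _; rewrite -mulr_sumr lax_column.
by move=> mu _; rewrite mulr_suml; apply: eq_bigr => nu _; ring.
Qed.

Lemma expand_homog z b : mdeg b != n -> expand z b = 0.
Proof.
move=> hb; rewrite /expand big1 // => nu _.
have [->|/wpow_homog e] := eqVneq ((laxvec (sparts nu))@_b) 0; first by rewrite mulr0.
by have := sparts_sum nu => h; case/eqP: hb; rewrite e subnK.
Qed.

(** Induction on the power of x_0: when the layers below [a] vanish, the coefficients with
    x_0-exponent [a] see only layer [a], whose power sum products are independent. *)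
Lemma expand_free z : (forall b, expand z b = 0) -> forall nu, z nu = 0.
Proof.
move=> H; suff K a : forall nu, (n - sumn (sparts nu) < a)%N -> z nu = 0.
  by move=> nu; apply: (K n.+1); rewrite ltnS leq_subr.
elim: a => // a IH nu; rewrite ltnS leq_eqVlt => /orP[/eqP ea|]; last exact: IH.
pose f mu := if (n - sumn (sparts mu) == a)%N then z mu else 0.
suff : f nu = 0 by rewrite /f ea eqxx.
move: nu {ea}; apply: (powprod_free (pt := sparts)); rewrite ?sparts_n0 //.
- exact: sparts_n0.
- exact: sparts_size.
- exact: sparts_perm.
move=> b b0; rewrite -[RHS](H (b + U_(ord0) *+ a)%MM); apply: eq_bigr => mu _.
rewrite /f /laxvec /wpow mpolyXn; case: ltngtP => h.
- by rewrite IH // !mul0r.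
- rewrite mcoeffMXif mulmn_le mnmDE mulmnE mnm1E b0 eqxx add0n mul1n leqNgt h /=.
  by rewrite mul0r mulr0.
by rewrite h [(b + _)%MM]addmC mcoeffMX.
Qed.

End Lax.

(** * The resolvent *)

Section Resolvent.
Variables (R : realType) (n : nat) (al X : R).
Local Notation N := n.+1.
Implicit Types (b : 'X_{1..N}) (j : 'I_N) (Z : 'X_{1..N} -> R).

(** For i below both exponents, the two pairs are strictly further apart than (b_0, b_j); besides
    the swap these are the places where [exch] reads its argument. *)
Definition spreads b j i : seq 'X_{1..N} :=
  [:: upd b j (b ord0 + b j - i) i; upd b j i (b ord0 + b j - i)].

Lemma mdeg_bound b j : mdeg b = n -> (b j <= n)%N.
Proof. by move=> e; rewrite -[leqRHS]e mdegE (bigD1 j) //= leq_addr. Qed.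

Lemma perm_upd b j u v : j != ord0 ->
  exists r, perm_eq b [:: b ord0, b j & r] /\ perm_eq (upd b j u v) [:: u, v & r].
Proof.
move=> j0; have [|r [h1 h2]] := @perm_mnm2_eq n b (upd b j u v) j j0.
  by move=> i /negbTE ij /negbTE i0; rewrite mnmE i0 ij.
by exists r; split=> //; rewrite upd0 updj in h2.
Qed.

Lemma perm_upd2 b j u v b' : j != ord0 -> b' \in [:: upd b j u v; upd b j v u] ->
  exists r, perm_eq b [:: b ord0, b j & r] /\ perm_eq b' [:: u, v & r].
Proof.
move=> j0; rewrite !inE => /orP[]/eqP ->; first exact: perm_upd.
have [r [h1 h2]] := perm_upd b v u j0; exists r; split=> //.
by apply: perm_trans h2 _; rewrite (perm_catCA [:: v] [:: u] r).
Qed.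

Lemma cherednik_local Z b :
  (forall j i b', j != ord0 -> (i < minn (b ord0) (b j))%N -> b' \in spreads b j i -> Z b' = 0) ->
  cherednik al Z b = al * (b ord0)%:R * Z b +
    \sum_(j < N | (b ord0 < b j)%N) (Z (upd b j (b j) (b ord0)) - Z b).
Proof.
move=> H; rewrite /cherednik; congr (_ + _).
rewrite [RHS]big_mkcond /= [LHS]big_mkcond /=; apply: eq_bigr => j _.
case: eqP => [->|/eqP j0] /=; first by rewrite ltnn.
rewrite /exch [X in _ + X]big1 ?addr0 // => i _.
by rewrite !(H j i) ?subrr // !inE ?eqxx ?orbT.
Qed.

Definition sqsum (s : seq nat) := (\sum_(k <- s) k ^ 2)%N.

Lemma sqsum_bound s : (sqsum s <= sumn s ^ 2)%N.
Proof.
elim: s => [|a s IH]; rewrite /sqsum ?big_nil // big_cons -/(sqsum s) /=; nia.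
Qed.

Definition is_resolvent (f z : subpart n -> R) : Prop :=
  forall mu, X * z mu - laxop al z mu = f mu.

Lemma resolvent_expand f z b : is_resolvent f z ->
  X * expand z b - cherednik al (expand z) b = expand f b.
Proof.
move=> H; rewrite -expand_laxop /expand mulr_sumr -sumrB; apply: eq_bigr => mu _.
rewrite -(H mu); ring.
Qed.

Lemma laxop_adjoint (z w : subpart n -> R) :
  \sum_mu weight n al (sparts mu) * laxop al z mu * w mu =
  \sum_mu weight n al (sparts mu) * z mu * laxop al w mu.
Proof.
rewrite /laxop.
rewrite (eq_bigr (fun mu => \sum_nu weight n al (sparts mu) * lax n al (sparts mu) (sparts nu) * z nu * w mu)); last first.
  by move=> mu _; rewrite mulr_sumr mulr_suml; apply: eq_bigr => nu _; ring.
rewrite exchange_big /=; apply: eq_bigr => nu _; rewrite mulr_sumr; apply: eq_bigr => mu _.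
rewrite lax_sym; ring.
Qed.

Lemma resolvent_adjoint f g z w : is_resolvent f z -> is_resolvent g w ->
  \sum_mu weight n al (sparts mu) * z mu * g mu = \sum_mu weight n al (sparts mu) * f mu * w mu.
Proof.
move=> hz hw.
rewrite (eq_bigr (fun mu => weight n al (sparts mu) * z mu * w mu * X - weight n al (sparts mu) * z mu * laxop al w mu)); last first.
  by move=> mu _; rewrite -(hw mu); ring.
rewrite [RHS](eq_bigr (fun mu => weight n al (sparts mu) * z mu * w mu * X - weight n al (sparts mu) * laxop al z mu * w mu)); last first.
  by move=> mu _; rewrite -(hz mu); ring.
by rewrite !sumrB laxop_adjoint.
Qed.

Lemma incl_proof (mu : intpart n) : is_subpart (intpart_bseq mu).
Proof. by case/and3P: (valP mu) => h1 h2 /eqP h3; rewrite /is_subpart h1 h2 h3 /=. Qed.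

Definition incl (mu : intpart n) : subpart n :=
  exist (fun s => is_subpart s) (intpart_bseq mu) (incl_proof mu).

Lemma sparts_incl mu : sparts (incl mu) = mu.
Proof. by []. Qed.

Lemma incl_inj : injective incl.
Proof. by move=> mu nu e; apply: parts_inj; rewrite -!sparts_incl e. Qed.

(** [f] as a vector of the larger space: the partitions of size below n, which carry a power of x_0,
    get coordinate 0. *)
Definition extend (f : intpart n -> R) (nu : subpart n) : R := \sum_(mu | incl mu == nu) f mu.

Lemma extend_sum (f : intpart n -> R) (G : subpart n -> R) :
  \sum_nu extend f nu * G nu = \sum_mu f mu * G (incl mu).
Proof.
rewrite (eq_bigr (fun nu => \sum_mu if incl mu == nu then f mu * G (incl mu) else 0)); last first.
  by move=> nu _; rewrite /extend mulr_suml big_mkcond; apply: eq_bigr => mu _; case: eqP => // ->.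
rewrite exchange_big /=; apply: eq_bigr => mu _.
by rewrite (bigD1 (incl mu)) //= eqxx big1 ?addr0 // => nu; rewrite eq_sym => /negbTE ->.
Qed.

Lemma sum_top (G : subpart n -> R) : (forall nu, sumn (sparts nu) != n -> G nu = 0) ->
  \sum_nu G nu = \sum_mu G (incl mu).
Proof.
move=> H; rewrite (bigID (fun nu => sumn (sparts nu) == n)) /= [X in _ + X]big1 ?addr0 //.
have sub (nu : subpart n) : sumn (sparts nu) = n -> exists mu, incl mu = nu.
  move=> e; have hb : is_intpart (val nu).
    by case/and3P: (sparts_props nu) => h1 h2 _; rewrite /is_intpart h1 h2 /= -/(sparts nu) e.
  by exists (IntPart hb); apply: val_inj.
rewrite (eq_bigl (mem (codom incl))); last first.
  move=> nu; apply/eqP/codomP => [/sub[mu <-]|[mu ->]]; first by exists mu.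
  by rewrite sparts_incl sumn_intpart.
have hu : uniq (codom incl) by rewrite map_inj_uniq ?enum_uniq //; exact: incl_inj.
by rewrite -(big_uniq _ hu) /= big_image.
Qed.

Lemma expand_extend (f : intpart n -> R) b :
  expand (extend f) b = (\sum_mu f mu *: powprod R n mu)@_b.
Proof.
rewrite /expand extend_sum raddf_sum /=; apply: eq_bigr => mu _.
by rewrite mcoeffZ sparts_incl /laxvec /wpow sumn_intpart subnn expr0 mulr1.
Qed.

Lemma expand_at0 z b : b ord0 = 0%N ->
  expand z b = (\sum_(mu : intpart n) z (incl mu) *: powprod R n mu)@_b.
Proof.
move=> b0; rewrite /expand sum_top => [|nu hn].
  rewrite raddf_sum /=; apply: eq_bigr => mu _.
  by rewrite mcoeffZ sparts_incl /laxvec /wpow sumn_intpart subnn expr0 mulr1.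
rewrite /laxvec /wpow mpolyXn mcoeffMXif mulmn_le b0 leqn0 subn_eq0 ifF ?mulr0 //.
by have := sparts_sum nu; lia.
Qed.

(** Pairing with a vector without powers of x_0 sees only the corresponding coordinates of [z];
    self-adjointness thus passes to the projected resolvent. *)
Lemma jack_dotE (f g : Defs.symf R n) (z : subpart n -> R) : (forall mu, z (incl mu) = g mu) ->
  jack_dot al f g = \sum_nu weight n al (sparts nu) * extend f nu * z nu.
Proof.
move=> h; rewrite (eq_bigr (fun nu => extend f nu * (weight n al (sparts nu) * z nu))); last by move=> nu _; ring.
rewrite extend_sum /jack_dot; apply: eq_bigr => mu _; rewrite h sparts_incl /weight /zee /zfactor /part_mult; ring.
Qed.

Hypotheses (al0 : 0 < al) (Xbig : al * n%:R < X).

(* Induction on the sum of the squares of the exponents, then on the exponent of x_0. *)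
Lemma resolvent_vanish (P : 'X_{1..N} -> Prop) Z :
  (forall b, mdeg b != n -> Z b = 0) ->
  (forall b j i b', j != ord0 -> (i < minn (b ord0) (b j))%N -> b' \in spreads b j i -> P b -> P b') ->
  (forall b j, j != ord0 -> P b -> P (upd b j (b j) (b ord0))) ->
  (forall b, P b -> X * Z b = cherednik al Z b) ->
  forall b, P b -> Z b = 0.
Proof.
move=> Zn Pspread Pswap HZ.
pose meas b := (sqsum b * n.+1 + b ord0)%N.
suff K d : forall b, P b -> (n ^ 2 * n.+1 + n < meas b + d)%N -> Z b = 0.
  by move=> b Pb; apply: (K (n ^ 2 * n.+1 + n).+1) => //; rewrite addnS ltnS leq_addl.
elim: d => [|d IH] b Pb.
  have [hb|hb] := eqVneq (mdeg b) n; last by rewrite Zn.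
  have := mdeg_bound ord0 hb; have := sqsum_bound b.
  rewrite sumnE -/(mdeg b) hb addn0 /meas; nia.
move=> hd; have [hb|hb] := eqVneq (mdeg b) n; last by rewrite Zn.
have hsp j i b' : j != ord0 -> (i < minn (b ord0) (b j))%N -> b' \in spreads b j i -> Z b' = 0.
  move=> j0 hi hb'; have [r [h1 h2]] := perm_upd2 j0 hb'.
  apply: IH; first exact: Pspread hb' Pb.
  have : (sqsum b < sqsum b')%N.
    rewrite /sqsum (perm_big _ h1) (perm_big _ h2) /= !big_cons !addnA ltn_add2r.
    nia.
  have := mdeg_bound ord0 hb; move: hd; rewrite /meas; nia.
have hsw j : (b ord0 < b j)%N -> Z (upd b j (b j) (b ord0)) = 0.
  move=> hj; have j0 : j != ord0 by apply: contraTneq hj => ->; rewrite ltnn.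
  apply: IH; first exact: Pswap.
  have [r [h1 h2]] := perm_upd b (b j) (b ord0) j0.
  have : sqsum b = sqsum (upd b j (b j) (b ord0)).
    by rewrite /sqsum (perm_big _ h1) (perm_big _ h2) /= !big_cons addnCA.
  move: hd; rewrite /meas upd0; nia.
have := HZ b Pb; rewrite cherednik_local // => e.
(* With spreads and swaps already zero, Z b keeps the factor X - al b_0 + #{j : b_j > b_0}, which is
   positive since al b_0 <= al n < X. *)
have {}e : (X - al * (b ord0)%:R + (\sum_(j < N | (b ord0 < b j)%N) 1)%N%:R) * Z b = 0.
  rewrite mulrDl mulrBl e natr_sum mulr_suml.
  rewrite [X in X - _ + _]addrC addrK -big_split big1 //= => j hj.
  by rewrite hsw // sub0r mul1r addNr.
apply/eqP; move/eqP: e; rewrite mulf_eq0 => /orP[|//].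
rewrite gt_eqF // ltr_wpDr ?ler0n // subr_gt0; apply: le_lt_trans Xbig.
by rewrite ler_pM2l // ler_nat mdeg_bound.
Qed.

(** [resolvent_vanish] on all exponents makes X - L injective, hence bijective on a
    finite-dimensional space. *)
Lemma resolvent_exists f : exists z, is_resolvent f z.
Proof.
pose V := {ffun subpart n -> R^o}.
pose T (z : V) : V := [ffun mu => X * z mu - laxop al z mu].
have Tlin : linear T.
  move=> c z w; apply/ffunP => mu; rewrite !ffunE /laxop.
  rewrite (eq_bigr (fun nu => c * (lax n al (sparts mu) (sparts nu) * z nu)
      + lax n al (sparts mu) (sparts nu) * w nu)).
    rewrite big_split /= -mulr_sumr /GRing.scale /=; ring.
  by move=> nu _; rewrite !ffunE /GRing.scale /=; ring.
pose TL := GRing.isLinear.Build _ _ _ _ T Tlin.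
pose Tl : {linear V -> V} := HB.pack T TL.
have ker0 : lker (linfun Tl) == 0%VS.
  apply/lker0P => z w; rewrite !lfunE /= => e.
  apply/eqP; rewrite -subr_eq0; apply/eqP/ffunP => mu; rewrite [RHS]ffunE.
  move: mu; apply: expand_free.
  have eT : is_resolvent (fun=> 0) (z - w).
    have hT : T (z - w) = 0 by rewrite [LHS](raddfB Tl z w) /= e subrr.
    by move=> mu; have /ffunP/(_ mu) := hT; rewrite !ffunE.
  move=> b; apply: (@resolvent_vanish (fun=> True)) => // [c|c _]; first exact: expand_homog.
  by apply/eqP; rewrite -subr_eq0 (resolvent_expand _ eT) /expand big1 // => nu _; rewrite mul0r.
pose F : V := [ffun mu => f mu].
exists ((linfun Tl)^-1%VF F) => mu.
have := lker0_lfunVK ker0 F; rewrite lfunE /= => /ffunP/(_ mu).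
by rewrite !ffunE.
Qed.

End Resolvent.

(** * Jack functions are eigenvectors of the resolvent *)

Section Eigenvalue.
Variables (R : realType) (n : nat) (al : R) (J : intpart n -> Defs.symf R n).
Hypotheses (al0 : 0 < al) (Jbasis : symf_basis J).
Hypothesis Jorth : forall la mu, la != mu -> jack_dot al (J la) (J mu) = 0.
Hypothesis Jmono : forall la, exists c : intpart n -> R,
  [/\ monomial_expansion (J la) c, forall mu, ~~ dominated mu la -> c mu = 0
    & forall mu, parts mu = nseq n 1%N -> c mu = n`!%:R].
Local Notation N := n.+1.
Implicit Types (b : 'X_{1..N}) (j : 'I_N) (la mu nu ka : intpart n).

Definition jcoeff la b : R := (\sum_nu J la nu *: powprod R n nu)@_b.
(** The coefficient of m_mu in J_la. *)
Definition mcoef la mu : R := jcoeff la (emb n mu).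

Lemma nz_emb_part mu : nz (emb n mu) = mu.
Proof. by rewrite nz_emb ?intpart_n0 ?size_intpart. Qed.

Lemma mcoef_expansion la (c : intpart n -> R) :
  monomial_expansion (J la) c -> forall mu, mcoef la mu = c mu.
Proof.
move=> h mu; rewrite /mcoef /jcoeff (expansion_coeff _ h) nz_emb_part (bigD1 mu) //=.
rewrite perm_refl mulr1 big1 ?addr0 // => nu ne; case: (boolP (perm_eq _ _)) => h'; last by rewrite mulr0.
by rewrite (perm_parts h') eqxx in ne.
Qed.

Lemma jcoeffE la b : jcoeff la b = \sum_mu mcoef la mu * (perm_eq (nz b) mu)%:R.
Proof.
have [c [h _ _]] := Jmono la; rewrite /jcoeff (expansion_coeff _ h).
by apply: eq_bigr => mu _; rewrite (mcoef_expansion h).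
Qed.

Lemma jcoeff_type la b mu : perm_eq (nz b) mu -> jcoeff la b = mcoef la mu.
Proof.
move=> hp; rewrite jcoeffE (bigD1 mu) //= hp mulr1 big1 ?addr0 // => nu ne.
case: (boolP (perm_eq _ _)) => h'; last by rewrite mulr0.
by case/eqP: ne; apply: perm_parts; apply: perm_trans hp; rewrite perm_sym.
Qed.

Lemma mnm_type b : mdeg b = n -> exists mu, perm_eq (nz b) mu.
Proof.
move=> e; have [|mu h] := @exists_intpart n (nz b) (nz_n0 b); first by rewrite sumn_nz.
by exists mu; rewrite perm_sym.
Qed.

Lemma jcoeff_homog la b : mdeg b != n -> jcoeff la b = 0.
Proof.
move=> hb; rewrite jcoeffE big1 // => mu _; case: (boolP (perm_eq _ _)) => h; last by rewrite mulr0.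
by rewrite -sumn_nz (perm_sumn h) sumn_intpart eqxx in hb.
Qed.

Lemma mcoef_dom la mu : ~~ dominated mu la -> mcoef la mu = 0.
Proof. by have [c [h1 h2 _]] := Jmono la; rewrite (mcoef_expansion h1); exact: h2. Qed.

Lemma mcoef_ones la mu : parts mu = nseq n 1%N -> mcoef la mu = n`!%:R.
Proof. by have [c [h1 _ h3]] := Jmono la; rewrite (mcoef_expansion h1); exact: h3. Qed.

Lemma J_free (d : intpart n -> R) :
  (forall mu, \sum_ka d ka * mcoef ka mu = 0) -> forall ka, d ka = 0.
Proof.
move=> H; pose D := [ffun ka => d ka].
have e : \sum_ka D ka *: J ka = 0.
  apply/ffunP => mu; rewrite [RHS]ffunE; move: mu.
  apply: (powprod_free (pt := @parts n)).
  - exact: intpart_n0.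
  - exact: size_intpart.
  - exact: perm_parts.
  move=> b _; transitivity (\sum_ka d ka * jcoeff ka b).
    rewrite (eq_bigr (fun mu => \sum_ka d ka * (J ka mu * (powprod R n mu)@_b))).
      rewrite exchange_big /=; apply: eq_bigr => ka _; rewrite -mulr_sumr; congr (_ * _).
      by rewrite /jcoeff raddf_sum; apply: eq_bigr => mu _; rewrite /= mcoeffZ.
    move=> mu _; rewrite sum_ffunE mulr_suml; apply: eq_bigr => ka _.
    by rewrite !ffunE mulrA.
  rewrite (eq_bigr (fun ka => \sum_mu (d ka * mcoef ka mu) * (perm_eq (nz b) mu)%:R)); last first.
    by move=> ka _; rewrite jcoeffE mulr_sumr; apply: eq_bigr => mu _; rewrite mulrA.
  rewrite exchange_big big1 //= => mu _; by rewrite -mulr_suml H mul0r.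
have [c [_ cu]] := Jbasis 0.
have h1 := cu D (esym e).
have h2 : c = 0 by apply: cu; rewrite big1 // => ka _; rewrite ffunE scale0r.
by move=> ka; have := congr1 (fun f : {ffun _ -> _} => f ka) (etrans (esym h1) h2); rewrite /= !ffunE.
Qed.

(* A vanishing diagonal coefficient would make J ka a combination of the J nu with nu strictly
   below ka. *)
Lemma mcoef_diag ka : mcoef ka ka != 0.
Proof.
(* The induction carries along the inverse triangular expansion: m_ka as a combination of the J nu
   with nu <= ka. *)
suff K m : forall ka, (rank ka < m)%N -> mcoef ka ka != 0 /\
    exists d : intpart n -> R, (forall nu, ~~ dominated nu ka -> d nu = 0) /\
      forall mu, \sum_nu d nu * mcoef nu mu = (ka == mu)%:R.
  by have [] := K _ ka (ltnSn _).
elim: m => // m IH {}ka; rewrite ltnS => hka.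
(* The range conditions sit below the existential so that one function collects all witnesses;
   outside the range the witness is a dummy. *)
have lo mu : exists d : intpart n -> R, dominated mu ka -> mu != ka ->
   (forall nu, ~~ dominated nu mu -> d nu = 0) /\
      forall mu', \sum_nu d nu * mcoef nu mu' = (mu == mu')%:R.
  case: (boolP (dominated mu ka && (mu != ka))) => [/andP[h1 h2]|h]; last first.
    by exists (fun=> 0) => h1 h2; rewrite h1 h2 in h.
  by have [_ [d hd]] := IH mu (leq_trans (rank_lt h1 h2) hka); exists d.
have [D HD] := fin_all_exists lo.
(* J ka minus its lower monomials, each rewritten through J: what remains is [mcoef ka ka] times
   m_ka, yet J ka itself keeps coefficient 1. *)
pose d' nu := (nu == ka)%:R - \sum_(mu | dominated mu ka && (mu != ka)) mcoef ka mu * D mu nu.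
have d'1 : d' ka = 1.
  rewrite /d' eqxx big1 ?subr0 // => mu /andP[h1 h2].
  have [h3 _] := HD mu h1 h2; rewrite h3 ?mulr0 //.
  by apply: contraNN h2 => h4; apply/eqP/dominated_antisym.
have d's mu' : \sum_nu d' nu * mcoef nu mu' = (ka == mu')%:R * mcoef ka ka.
  transitivity (mcoef ka mu' - \sum_(mu | dominated mu ka && (mu != ka)) mcoef ka mu * (mu == mu')%:R).
    rewrite /d' (eq_bigr (fun nu => (nu == ka)%:R * mcoef nu mu' -
       \sum_(mu | dominated mu ka && (mu != ka)) mcoef ka mu * (D mu nu * mcoef nu mu'))); last first.
      by move=> nu _; rewrite mulrBl mulr_suml; congr (_ - _); apply: eq_bigr => mu _; rewrite mulrA.
    rewrite sumrB; congr (_ - _).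
      by rewrite (bigD1 ka) //= eqxx mul1r big1 ?addr0 // => nu /negbTE ->; rewrite mul0r.
    rewrite exchange_big /=; apply: eq_bigr => mu /andP[h1 h2].
    by rewrite -mulr_sumr (HD mu h1 h2).2.
  have [<-|ne] := eqVneq ka mu'.
    rewrite mul1r big1 ?subr0 // => mu /andP[_ /negbTE ->]; by rewrite mulr0.
  rewrite mul0r; case: (boolP (dominated mu' ka)) => h.
    rewrite (bigD1 mu') /=; last by rewrite h eq_sym.
    rewrite eqxx mulr1 big1 ?addr0 ?subrr // => mu /andP[_ /negbTE ->]; by rewrite mulr0.
  rewrite mcoef_dom // big1 ?subr0 // => mu /andP[h1 _].
  by case: eqP => [e|]; rewrite ?mulr0 // -e h1 in h *.
have nz0 : mcoef ka ka != 0.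
  apply/eqP => e0; have : d' ka = 0 by apply: J_free => mu; rewrite d's e0 mulr0.
  by rewrite d'1 => /eqP; rewrite oner_eq0.
split=> //; exists (fun nu => d' nu / mcoef ka ka); split.
  move=> nu hnu; rewrite /d' (_ : nu == ka = false).
    rewrite sub0r big1 ?oppr0 ?mul0r // => mu /andP[h1 h2].
    have [h3 _] := HD mu h1 h2; rewrite h3 ?mulr0 //.
    by apply: contraNN hnu => h4; exact: dominated_trans h4 h1.
  by apply: contraNF hnu => /eqP ->; exact: dominated_refl.
move=> mu; rewrite (eq_bigr (fun nu => (d' nu * mcoef nu mu) / mcoef ka ka)); last by move=> nu _; rewrite mulrAC.
by rewrite -mulr_suml d's mulfK.
Qed.

Lemma jack_norm la : jack_dot al (J la) (J la) != 0.
Proof.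
apply/eqP => e.
have w0 mu : 0 < al ^+ size mu * (zee mu)%:R :> R.
  rewrite mulr_gt0 ?exprn_gt0 // ltr0n /zee big_seq; apply: prodn_cond_gt0 => i.
  by rewrite mem_index_iota => /andP[i0 _]; rewrite muln_gt0 expn_gt0 i0 fact_gt0.
have J0 mu : J la mu = 0.
  have := psumr_eq0P (P := xpredT) (F := fun mu => J la mu * J la mu * (al ^+ size mu * (zee mu)%:R)).
  have h nu : true -> 0 <= J la nu * J la nu * (al ^+ size nu * (zee nu)%:R) :> R.
    by move=> _; apply: mulr_ge0; [rewrite -expr2; exact: sqr_ge0|exact: ltW].
  move=> /(_ h e mu isT)/eqP; rewrite mulf_eq0 (gt_eqF (w0 mu)) orbF -expr2 sqrf_eq0.
  by move/eqP.
have := mcoef_diag la; rewrite /mcoef /jcoeff big1 ?mcoeff0 ?eqxx // => nu _.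
by rewrite J0 scale0r.
Qed.

(** * Triangularity of the resolvent for dominance *)

Section Resolve.
Variables (X : R) (Xbig : al * n%:R < X).

Lemma dom_spread b j i b' la : j != ord0 -> (i < minn (b ord0) (b j))%N ->
  b' \in spreads b j i -> dom b' la -> dom b la.
Proof.
move=> j0 hi hb' hd t; apply: leq_trans (hd t); have [r [h1 h2]] := perm_upd2 j0 hb'.
rewrite (excess_perm t h1) (excess_perm t h2) /excess !big_cons !addnA leq_add2r.
exact: excess_spread.
Qed.

Lemma not_dom_spread b j i b' la : j != ord0 -> (i < minn (b ord0) (b j))%N ->
  b' \in spreads b j i -> perm_eq (nz b) la -> ~ dom b' la.
Proof.
move=> j0 hi hb' hp /(_ (maxn (b ord0) (b j))); set t := maxn _ _.
rewrite -(excess_perm t hp) excess_mnm; have [r [h1 h2]] := perm_upd2 j0 hb'.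
rewrite (excess_perm t h1) (excess_perm t h2) /excess !big_cons !addnA leq_add2r leqNgt.
by rewrite excess_spread_strict.
Qed.

Variables (la : intpart n) (z : subpart n -> R).
Hypothesis hz : is_resolvent al X (extend (J la)) z.
Let Z := expand z.

Lemma resolvent_jack b : X * Z b - cherednik al Z b = jcoeff la b.
Proof. by rewrite (resolvent_expand _ hz) expand_extend. Qed.

Lemma jcoeff_dom b : ~ dom b la -> jcoeff la b = 0.
Proof.
move=> hd; have [hb|hb] := eqVneq (mdeg b) n; last exact: jcoeff_homog.
have [mu hmu] := mnm_type hb; rewrite (jcoeff_type _ hmu) mcoef_dom //.
apply/dominatedP => h; apply: hd => t; rewrite -excess_mnm (excess_perm t hmu); exact: h.
Qed.

(** The exponents not dominated by [la] are closed under spreads and swaps, and the source J_la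
    vanishes on them. *)
Lemma resolvent_dom b : ~ dom b la -> Z b = 0.
Proof.
apply: (resolvent_vanish al0 Xbig (P := fun b => ~ dom b la)); first exact: expand_homog.
- by move=> c j i c' j0 hi hc' h h'; apply: h; exact: dom_spread hc' h'.
- move=> c j j0 h h'; apply: h => t; apply: leq_trans (h' t).
  have [r [h1 h2]] := perm_upd c (c j) (c ord0) j0.
  by rewrite (excess_perm t h1) (excess_perm t h2) /excess !big_cons addnCA.
- by move=> c hc; apply/eqP; rewrite -subr_eq0 resolvent_jack jcoeff_dom.
Qed.

(** Spreads of a rearrangement of [la] are not dominated by [la], so the equation couples
    rearrangements only, through swaps that raise the exponent of x_0. Downward induction on that
    exponent reduces it to the scalar recursion for [v]. *)
Lemma resolvent_top (v : nat -> R) b :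
  (forall r, (r <= n)%N -> (X - al * r%:R + (count (leq r.+1) la)%:R) * v r =
     1 + \sum_(k <- la | (r < k)%N) v k) ->
  perm_eq (nz b) la -> Z b = mcoef la la * v (b ord0).
Proof.
move=> hv; have [d hd] := ubnP (n - b ord0)%N; elim: d b hd => // d IH b hd hp.
have hb : mdeg b = n by rewrite -sumn_nz (perm_sumn hp) sumn_intpart.
have := resolvent_jack b; rewrite (jcoeff_type _ hp) cherednik_local; last first.
  by move=> j i b' j0 hi hb'; apply: resolvent_dom; exact: not_dom_spread hb' hp.
have b0n := mdeg_bound ord0 hb; have hr := hv _ b0n; set r := b ord0 in hr b0n *.
rewrite (eq_bigr (fun j => mcoef la la * v (b j) - Z b)) => [|j hj]; last first.
  have j0 : j != ord0 by apply: contraTneq hj => ->; rewrite ltnn.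
  have bj := mdeg_bound j hb.
  rewrite IH ?upd0 //; first by lia.
  have [q [h1 h2]] := perm_upd b (b j) (b ord0) j0.
  apply: perm_trans hp; apply: perm_trans (perm_nz h2) _.
  rewrite perm_sym; apply: perm_trans (perm_nz h1) _; apply: perm_filter.
  by rewrite (perm_catCA [:: b ord0] [:: b j] q).
have hs (F : nat -> R) : \sum_(j < N | (r < b j)%N) F (b j) = \sum_(k <- la | (r < k)%N) F k.
  rewrite -(perm_big _ hp) /= /nz big_filter_cond mnm_seqE big_map big_enum_cond /=.
  by apply: eq_bigl => j; case: (b j).
rewrite sumrB (hs (fun k => mcoef la la * v k)) (hs (fun=> Z b)) -mulr_sumr.
have -> : \sum_(k <- la | (r < k)%N) Z b = (count (leq r.+1) la)%:R * Z b.
  by rewrite big_const_seq iter_addr_0 mulr_natl.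
move=> e.
have pos : 0 < X - al * r%:R + (count (leq r.+1) la)%:R.
  rewrite ltr_wpDr ?ler0n // subr_gt0; apply: le_lt_trans Xbig.
  by rewrite ler_pM2l // ler_nat.
apply: (mulfI (lt0r_neq0 pos)); rewrite mulrCA hr.
by rewrite mulrDr mulr1 -{1}e; ring.
Qed.

Definition res_part : Defs.symf R n := [ffun mu => z (incl mu)].

Lemma resolvent_at0 b : b ord0 = 0%N -> Z b = (\sum_mu res_part mu *: powprod R n mu)@_b.
Proof. by move=> b0; rewrite /Z expand_at0 //; congr (_@__); apply: eq_bigr => mu _; rewrite ffunE. Qed.

Lemma resolvent_at0_basis (d : intpart n -> R) b : res_part = \sum_ka d ka *: J ka ->
  b ord0 = 0%N -> Z b = \sum_ka d ka * jcoeff ka b.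
Proof.
move=> e b0; rewrite resolvent_at0 // e raddf_sum /=.
rewrite (eq_bigr (fun mu => \sum_ka d ka * (J ka mu * (powprod R n mu)@_b))).
  rewrite exchange_big /=; apply: eq_bigr => ka _; rewrite -mulr_sumr; congr (_ * _).
  by rewrite /jcoeff raddf_sum; apply: eq_bigr => mu _; rewrite /= mcoeffZ.
move=> mu _; rewrite mcoeffZ sum_ffunE mulr_suml; apply: eq_bigr => ka _.
by rewrite ffunE /GRing.scale /= mulrA.
Qed.

(** An offending [ka] of maximal rank would be the only contributor to the coefficient of m_ka,
    which [resolvent_dom] makes zero. *)
Lemma res_support (d : intpart n -> R) : res_part = \sum_ka d ka *: J ka ->
  forall ka, d ka != 0 -> dominated ka la.
Proof.
move=> e ka0 h0; apply: contraT => hd0.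
have P0 : (d ka0 != 0) && ~~ dominated ka0 la by rewrite h0.
have [ka /andP[hk hkd] hmax] :=
  @arg_maxnP _ ka0 (fun ka => (d ka != 0) && ~~ dominated ka la) (@rank n) P0.
have := resolvent_at0_basis e (emb0 n ka); rewrite resolvent_dom; last first.
  move=> h; case/negP: hkd; apply/dominatedP => t.
  by rewrite -[X in excess t X]nz_emb_part excess_mnm; exact: h.
rewrite (bigD1 ka) //= big1 ?addr0 => [|nu ne].
  by move/esym/eqP; rewrite mulf_eq0 (negbTE hk) (negbTE (mcoef_diag ka)).
have [->|hnu] := eqVneq (d nu) 0; first by rewrite mul0r.
case: (boolP (dominated ka nu)) => hkn; last by rewrite -/(mcoef nu ka) mcoef_dom ?mulr0.
have lt := rank_lt hkn (_ : ka != nu); rewrite eq_sym in lt.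
have := hmax nu; rewrite hnu /= leqNgt lt // => /(_ _)/negP; case.
  by apply: contraNN hkd => h; exact: dominated_trans hkn h.
by [].
Qed.

End Resolve.

(* A constituent J ka of the part of the resolvent of J la free of x_0 satisfies ka <= la by
   triangularity and la <= ka by self-adjointness. *)
Lemma resolvent_eigen X la z (v : nat -> R) : al * n%:R < X ->
  is_resolvent al X (extend (J la)) z ->
  (forall r, (r <= n)%N -> (X - al * r%:R + (count (leq r.+1) la)%:R) * v r =
     1 + \sum_(k <- la | (r < k)%N) v k) ->
  forall b, b ord0 = 0%N -> expand z b = v 0%N * jcoeff la b.
Proof.
move=> Xbig hz hv b b0.
have [c [ec _]] := Jbasis (res_part z).
have hoff ka : ka != la -> c ka = 0.
  move=> ne; apply/eqP; apply: contraT => hc.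
  have d1 := res_support Xbig hz ec hc.
  have [w hw] := resolvent_exists al0 Xbig (extend (J ka)).
  have [d [ed _]] := Jbasis (res_part w).
  have dot_lin (e : {ffun intpart n -> R}) (f : Defs.symf R n) : jack_dot al f (\sum_nu e nu *: J nu) =
      \sum_nu e nu * jack_dot al f (J nu).
    rewrite /jack_dot (eq_bigr (fun mu => \sum_nu e nu * (f mu * J nu mu * (al ^+ size mu * (zee mu)%:R)))).
      by rewrite exchange_big; apply: eq_bigr => nu _; rewrite mulr_sumr.
    move=> mu _; rewrite sum_ffunE mulr_sumr mulr_suml; apply: eq_bigr => nu _.
    by rewrite ffunE /GRing.scale /=; ring.
  (* By orthogonality this equality reads c_ka |J_ka|^2 = d_la |J_la|^2, so c_ka != 0 forces d_la !=
     0 and then la <= ka. *)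
  have E : jack_dot al (J ka) (res_part z) = jack_dot al (J la) (res_part w).
    rewrite (@jack_dotE _ _ _ _ _ z); last by move=> mu; rewrite ffunE.
    rewrite (@jack_dotE _ _ _ _ _ w); last by move=> mu; rewrite ffunE.
    rewrite -(resolvent_adjoint hz hw); apply: eq_bigr => mu _; ring.
  move: E; rewrite ec ed !dot_lin (bigD1 ka) //= big1 ?addr0; last first.
    by move=> nu nk; rewrite Jorth ?mulr0 // eq_sym.
  rewrite [RHS](bigD1 la) //= [X in _ = _ + X]big1 ?addr0; last first.
    by move=> nu nk; rewrite Jorth ?mulr0 // eq_sym.
  have [d0|hd] := eqVneq (d la) 0.
    by rewrite d0 mul0r => /eqP; rewrite mulf_eq0 (negbTE hc) (negbTE (jack_norm ka)).
  have d2 := res_support Xbig hw ed hd.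
  by case/eqP: ne; exact: dominated_antisym.
have hon : c la = v 0%N.
  have hp : perm_eq (nz (emb n la)) la by rewrite nz_emb_part perm_refl.
  have := resolvent_at0_basis ec (emb0 n la); rewrite (resolvent_top Xbig hz hv hp) emb0.
  rewrite (bigD1 la) //= big1 ?addr0 => [|ka ne]; last by rewrite hoff // mul0r.
  by rewrite -/(mcoef la la) mulrC => /(mulIf (mcoef_diag la)).
rewrite (resolvent_at0_basis ec b0) (bigD1 la) //= big1 ?addr0 => [|ka ne]; first by rewrite hon.
by rewrite hoff // mul0r.
Qed.

End Eigenvalue.

(** * The recursion for hook coefficients *)

Section Hooks.
Variables (R : realType) (n : nat) (al : R) (J : intpart n -> Defs.symf R n).
Local Notation N := n.+1.
Implicit Types (b : 'X_{1..N}) (j : 'I_N) (la mu : intpart n).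

Definition hookset k : {set 'I_N} := [set i : 'I_N | (0 < i <= n - k)%N].

Lemma ord0_hookset k : ord0 \notin hookset k.
Proof. by rewrite inE. Qed.

Lemma card_hookset k : #|hookset k| = (n - k)%N.
Proof.
by apply: card_ord_range; rewrite leq_subr.
Qed.

Lemma jcoeff_upd la b j u v : j != ord0 -> jcoeff J la (upd b j u v) = jcoeff J la (upd b j v u).
Proof.
move=> j0; apply: sym_upd => //; apply: rpred_sum => mu _; apply: rpredZ; exact: powprod_sym.
Qed.

(** The g_k of the overview: division by (n-k)! turns the falling factorial of [powprod_hook] into a
    binomial. *)
Definition gcoef la k : R := \sum_mu J la mu * 'C(count_mem 1%N mu, n - k)%:R.

Lemma jcoeff_hook la k (A : {set 'I_N}) : (k <= n)%N -> ord0 \notin A -> #|A| = (n - k)%N ->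
  jcoeff J la (hook k A) = (n - k)`!%:R * gcoef la k.
Proof.
move=> kn A0 hA; rewrite /jcoeff raddf_sum mulr_sumr; apply: eq_bigr => mu _ /=.
rewrite mcoeffZ powprod_hook ?intpart_n0 ?sumn_intpart ?hA ?subnKC //.
by rewrite -bin_ffact natrM; ring.
Qed.

Lemma hook_upd k (A : {set 'I_N}) j l : j != ord0 ->
  upd (hook k A) j l 0 = hook l (A :\ j).
Proof.
move=> j0; apply/mnmP => i; rewrite !mnmE !inE; case: eqP => // _.
by case: eqP.
Qed.

Lemma expand_tperm (z : subpart n -> R) b j l : j != ord0 -> l != ord0 ->
  expand z [multinom b (tperm j l i) | i < N] = expand z b.
Proof.
move=> j0 l0; apply: eq_bigr => nu _; congr (_ * _); rewrite /laxvec /wpow !mpolyXn !mcoeffMXif !mulmn_le mnmE.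
have t0 : tperm j l ord0 = ord0 by rewrite tpermD.
rewrite t0; case: ifP => // _; rewrite -(msym_coeff _ (tperm j l) (powprod_sym _ _ _)).
congr (_@__); apply/mnmP => i; rewrite !(mnmE, mnmBE, mulmnE, mnm1E).
have -> : (ord0 == tperm j l i) = (ord0 == i) by rewrite -{1}t0 (inj_eq perm_inj).
by rewrite tpermK.
Qed.

Lemma hook_tperm k (A : {set 'I_N}) j l : j != ord0 -> l != ord0 -> j \in A -> l \in A ->
  [multinom hook k (A :\ l) (tperm j l i) | i < N] = hook k (A :\ j).
Proof.
move=> j0 l0 jA lA; apply/mnmP => i; rewrite !mnmE !inE.
case: tpermP => [->|->|/eqP h1 /eqP h2].
- by rewrite (negbTE l0) (negbTE j0) !eqxx.
- by rewrite (negbTE l0) (negbTE j0) [l == j]eq_sym jA lA.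
- by rewrite h1 h2.
Qed.

Lemma hookset_last k (l : 'I_N) : (k < n)%N -> l = (n - k)%N :> nat ->
  hookset k :\ l = hookset k.+1.
Proof.
move=> kn hl; apply/setP => i; rewrite !inE -val_eqE /= hl; lia.
Qed.

Variables (X : R) (la : intpart n) (z : subpart n -> R) (tau : R).
Hypothesis Zeq : forall b, X * expand z b - cherednik al (expand z) b = jcoeff J la b.
Hypothesis Z0 : forall b, b ord0 = 0%N -> expand z b = tau * jcoeff J la b.

(** Against an exponent 1 only one exchange survives, x_0^(k+1) minus x_j^(k+1). The second monomial
    is free of x_0, so its value is known from the eigenvalue; this closes the recursion on
    hooks. *)
Lemma exch_hook k j : j != ord0 ->
  exch (expand z) j (hook k (hookset k)) =
  if j \in hookset k then
    expand z (hook k.+1 (hookset k :\ j)) - tau * jcoeff J la (hook k.+1 (hookset k :\ j))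
  else 0.
Proof.
move=> j0; rewrite /exch hook0 hookj //; case jA: (j \in hookset k) => /=; last first.
  by rewrite minn0 big_ord0 addr0.
rewrite -(hook_upd k _ _ j0) jcoeff_upd // -Z0 ?upd0 //.
have [k0|k0] := posnP k.
  rewrite k0 in jA *; rewrite min0n big_ord0 addr0; congr (_ - expand z _).
  by apply/mnmP => i; rewrite !mnmE; case: eqP => // _; case: eqP => [->|//]; rewrite jA.
by rewrite ltnNge k0 add0r (minn_idPr k0) big_ord1 subn0 addn1.
Qed.

(** The factorial absorbs the factor n - k produced by the n - k equal exchange terms. *)
Definition hookval k : R := expand z (hook k (hookset k)) / (n - k)`!%:R.

Lemma hookval_step k : (k < n)%N ->
  hookval k.+1 = (X - al * k%:R) * hookval k + tau * gcoef la k.+1 - gcoef la k.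
Proof.
move=> kn; have := Zeq (hook k (hookset k)).
rewrite jcoeff_hook ?card_hookset ?ord0_hookset //; last exact: ltnW.
have hl : (n - k < n.+1)%N by rewrite ltnS leq_subr.
pose l : 'I_N := Ordinal hl.
have l0 : l != ord0 by rewrite -val_eqE /= subn_eq0 -ltnNge.
have lA : l \in hookset k by rewrite inE /= subn_gt0 kn leqnn.
(* By symmetry in x_1, ..., x_n, removing any position from [hookset k] gives the same value as
   removing its last position n - k. *)
rewrite /cherednik hook0 (eq_bigr (fun j => if j \in hookset k then
  expand z (hook k.+1 (hookset k.+1)) - tau * ((n - k.+1)`!%:R * gcoef la k.+1) else 0)); last first.
  move=> j j0; rewrite exch_hook //; case: ifP => // jA.
  rewrite -[in expand z _](hook_tperm k.+1 j0 l0 jA lA) expand_tperm // (hookset_last kn) //.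
  congr (_ - tau * _); rewrite jcoeff_hook //; first by rewrite in_setD1 negb_and ord0_hookset orbT.
  by have := cardsD1 j (hookset k); rewrite jA card_hookset subnS => ->.
rewrite -big_mkcondr sumr_const.
have -> : #|[pred j : 'I_N | (j != ord0) && (j \in hookset k)]| = (n - k)%N.
  by rewrite -(card_hookset k); apply: eq_card => i; rewrite !inE; case: eqP => // ->.
have fn0 m : m`!%:R != 0 :> R by rewrite pnatr_eq0 -lt0n fact_gt0.
have e : (n - k)`!%:R = (n - k)%:R * (n - k.+1)`!%:R :> R.
  by rewrite -natrM -[in RHS](subnSK kn) -factS subnSK.
have nk0 : (n - k)%:R != 0 :> R by rewrite pnatr_eq0 subn_eq0 -ltnNge.
rewrite -[(_ - _) *+ _]mulr_natl e /hookval e => E.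
set a := expand z (hook k _) in E *; set c := expand z (hook k.+1 _) in E *.
have h1 := fn0 (n - k.+1)%N; set f := (n - k.+1)`!%:R in h1 E *; set m := (n - k)%:R in nk0 E *.
have -> : gcoef la k = (X * a - (al * k%:R * a + m * (c - tau * (f * gcoef la k.+1)))) / (m * f).
  by rewrite E mulrAC divff ?mul1r // mulf_neq0.
by field; rewrite nk0 h1.
Qed.

(** At k = n no variable is left to exchange. Together with the initial value this overdetermines
    the first-order recursion, which is the source of the solvability condition. *)
Lemma hookval_last : (X - al * n%:R) * hookval n = gcoef la n.
Proof.
have := Zeq (hook n (hookset n)); rewrite jcoeff_hook ?card_hookset ?ord0_hookset //.
rewrite /cherednik hook0 big1 => [|j j0]; last by rewrite exch_hook // inE subnn; case: (val j).
by rewrite addr0 /hookval subnn fact0 mul1r divr1 mulrBl.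
Qed.

Lemma hookval_first : hookval 0 = tau * gcoef la 0.
Proof.
rewrite /hookval Z0 ?hook0 // jcoeff_hook ?card_hookset ?ord0_hookset // subn0.
have : n`!%:R != 0 :> R by rewrite pnatr_eq0 -lt0n fact_gt0.
by move=> h; rewrite mulrCA mulrC mulKf.
Qed.

End Hooks.

(** * Solving the recursion *)

Section EigenvalueFormula.
Variables (R : realType) (al X : R) (s : seq nat) (M : nat).
Hypothesis sM : forall k, k \in s -> (k <= M)%N.
Let cnt i : R := (count (leq i) s)%:R.
Let den i : R := X - al * i%:R + cnt i.+1.
Let num i : R := X - al * i%:R + cnt i.
Hypothesis den0 : forall i, (i <= M)%N -> den i != 0.

(* With s = la, top_coef r is the coefficient of the monomials of type la and x_0-exponent r in
   the resolvent of m_la, up to lower terms. *)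
Definition top_coef r : R := (\prod_(r.+1 <= i < M.+1) (num i / den i)) / den r.

Lemma count_leqS i : count (leq i) s = (count_mem i s + count (leq i.+1) s)%N.
Proof. elim: s => //= a u ->; case: (ltngtP i a) => /=; lia. Qed.

(** Since [num i] is [den i] plus the multiplicity of i in [s], the factor at r + 1 splits off the
    terms k = r + 1 of the sum. *)
Lemma top_coef_sum r : \prod_(r.+1 <= i < M.+1) (num i / den i) =
  1 + \sum_(k <- s | (r < k)%N) top_coef k.
Proof.
have [d hd] := ubnP (M - r)%N; elim: d r hd => // d IH r hd.
have [hr|hr] := leqP M r.
  rewrite big_geq // big_seq_cond big1 ?addr0 // => k /andP[/sM h1 h2]; lia.
rewrite big_ltn // IH; last lia.
have -> : \sum_(k <- s | (r < k)%N) top_coef k =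
   (count_mem r.+1 s)%:R * top_coef r.+1 + \sum_(k <- s | (r.+1 < k)%N) top_coef k.
  rewrite (bigID (pred1 r.+1)) /=; congr (_ + _).
    rewrite (eq_bigl (pred1 r.+1)); last by move=> k /=; case: eqP => [->|]; rewrite ?ltnSn ?andbF.
    rewrite (eq_bigr (fun=> top_coef r.+1)); last by move=> k /eqP ->.
    by rewrite big_const_seq iter_addr_0 mulr_natl.
  by apply: eq_bigl => k /=; lia.
have e : num r.+1 = (count_mem r.+1 s)%:R + den r.+1.
  by rewrite /num /den /cnt count_leqS natrD; ring.
rewrite -IH; last lia.
rewrite e mulrDl divff ?den0 // mulrDl mul1r addrA [1 + _]addrC -addrA.
have -> : 1 + \sum_(k <- s | (r.+1 < k)%N) top_coef k = \prod_(r.+2 <= i < M.+1) (num i / den i).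
  by rewrite IH //; lia.
rewrite {1}/top_coef; ring.
Qed.

Lemma top_coef_eq r : (r <= M)%N ->
  (X - al * r%:R + (count (leq r.+1) s)%:R) * top_coef r = 1 + \sum_(k <- s | (r < k)%N) top_coef k.
Proof.
by move=> hr; rewrite -top_coef_sum /top_coef -/(cnt _) -/(den r) mulrC divfK ?den0.
Qed.

End EigenvalueFormula.

(** * Polynomials determined by difference equations and by falling products *)

Section Uniqueness.
Variable R : realType.
Implicit Types (p q : {poly R}) (al X : R).

Lemma poly_ray_eq0 p X al : al != 0 -> (forall k : nat, p.[X + k%:R * al] = 0) -> p = 0.
Proof.
move=> al0 H; apply/eqP; apply: contraT => p0.
pose rs := [seq X + k%:R * al | k <- iota 0 (size p)].
have : (size rs < size p)%N.
  apply: max_poly_roots p0 _ _.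
    by apply/allP => x /mapP[k _ ->]; apply/rootP.
  rewrite map_inj_uniq ?iota_uniq // => k l /addrI/(mulIf al0)/eqP.
  by rewrite eqr_nat => /eqP.
by rewrite size_map size_iota ltnn.
Qed.

(* p / q is al-periodic on a ray, hence constant. *)
Lemma monic_shift_eq p q al B : 0 < al -> p \is monic -> q \is monic -> size p = size q ->
  (forall X, B < X -> q.[X] != 0) ->
  (forall X, B < X -> p.[X - al] * q.[X] = p.[X] * q.[X - al]) -> p = q.
Proof.
move=> al0 pm qm pq q0 H.
have up X k : B < X -> B < X + k%:R * al.
  by move=> hX; apply: lt_le_trans hX _; rewrite lerDl mulr_ge0 // ltW.
have step X k : B < X -> p.[X] * q.[X + k%:R * al] = p.[X + k%:R * al] * q.[X].
  move=> hX; elim: k => [|k IH]; first by rewrite mul0r addr0.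
  have e : X + k%:R * al = X + k.+1%:R * al - al by rewrite -natr1; ring.
  have := H _ (up X k.+1 hX); rewrite -e => h.
  apply: (mulIf (q0 _ (up X k hX))).
  by rewrite mulrAC IH mulrAC h; ring.
have const X : B < X -> p.[X] = q.[X].
  (* With X fixed, this combination vanishes on the whole ray from X by [step]; comparing leading
     coefficients of monic polynomials gives equal values at X. *)
  move=> hX; have e : p.[X] *: q - q.[X] *: p = 0.
    apply: (@poly_ray_eq0 _ X al); first by rewrite gt_eqF.
    by move=> k; rewrite !(hornerD, hornerN, hornerZ) step // mulrC subrr.
  have := congr1 (fun r : {poly R} => r`_(size q).-1) e.
  rewrite coefB !coefZ coef0 -{2}pq -!lead_coefE (monicP pm) (monicP qm) !mulr1.
  by move/eqP; rewrite subr_eq0 => /eqP.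
apply/eqP; rewrite -subr_eq0; apply/eqP; apply: (@poly_ray_eq0 _ (B + al) al); first by rewrite gt_eqF.
by move=> k; rewrite hornerD hornerN const ?subrr //; apply: up; rewrite ltrDl.
Qed.

Definition falling al M k : {poly R} := \prod_(k <= i < M) ('X - (al * i%:R)%:P).

Lemma falling_eval al M k X : (falling al M k).[X] = \prod_(k <= i < M) (X - al * i%:R).
Proof. by rewrite /falling horner_prod; apply: eq_bigr => i _; rewrite !hornerE. Qed.

Lemma falling_monic al M k : falling al M k \is monic.
Proof. by apply: monic_prod => i _; rewrite monicXsubC. Qed.

Lemma falling_size al M k : size (falling al M k) = (M - k).+1.
Proof. by rewrite /falling size_prod_XsubC size_iota. Qed.

Lemma falling_free al M (c : nat -> R) : al != 0 ->
  \sum_(k < M.+1) c k *: falling al M k = 0 -> forall k, (k <= M)%N -> c k = 0.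
Proof.
move=> al0 H; suff K d : forall k, (k <= M)%N -> (M - k < d)%N -> c k = 0.
  by move=> k hk; exact: (K (M - k).+1).
elim: d => // d IH k hk hd.
(* For i <= M, al (k - 1) is a root of [falling al M i] exactly when i < k; the subtraction is in R,
   so k = 0 fits too. The indices above k are settled by the induction. *)
have := congr1 (fun p : {poly R} => p.[al * (k%:R - 1)]) H.
have hk1 : (k < M.+1)%N by [].
rewrite horner0 horner_sum (bigD1 (Ordinal hk1)) //= big1 ?addr0 => [|i].
  move/eqP; rewrite hornerZ mulf_eq0 => /orP[/eqP //|]; rewrite falling_eval.
  rewrite big_seq prodf_seq_eq0 => /hasP[i]; rewrite mem_index_iota => /andP[ki _] /=.
  rewrite -mulrBr mulf_eq0 (negbTE al0) /= ki => /andP[_].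
  rewrite subr_eq0 => /eqP e.
  have : k%:R - 1 < i%:R :> R by rewrite ltrBlDr natr1 ltr_nat ltnS.
  by rewrite e ltxx.
rewrite -val_eqE /= neq_ltn hornerZ => /orP[ik|ki].
  rewrite falling_eval; have kk : k.-1 \in index_iota i M by rewrite mem_index_iota; lia.
  rewrite (big_rem _ kk) /= (_ : al * (k%:R - 1) - al * k.-1%:R = 0) ?mul0r ?mulr0 //.
  by rewrite -mulrBr -{1}(ltn_predK ik) -natr1 addrK subrr mulr0.
by have hi := ltn_ord i; rewrite IH ?mul0r //; lia.
Qed.

End Uniqueness.

(** * Elimination of the resolvent values from the hook recursion *)

Section HookSystem.
Variables (R : realType) (n M : nat) (al X tau : R) (g z : nat -> R).
Hypotheses (Mn : (M <= n)%N) (al0 : 0 < al) (Xbig : al * n%:R < X).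
Hypothesis zS : forall k, (k < n)%N -> z k.+1 = (X - al * k%:R) * z k + tau * g k.+1 - g k.
Hypothesis z0 : z 0%N = tau * g 0%N.
Hypothesis zn : (X - al * n%:R) * z n = g n.
Hypothesis gM : forall k, (M < k <= n)%N -> g k = 0.

Let Q m := \prod_(0 <= i < m) (X - al * i%:R).

Lemma hook_factor_gt0 i : (i <= n)%N -> 0 < X - al * i%:R.
Proof.
by move=> h; rewrite subr_gt0; apply: le_lt_trans Xbig; rewrite ler_pM2l // ler_nat.
Qed.

Lemma hook_den_neq0 m : (m <= n.+1)%N -> Q m != 0.
Proof.
move=> h; rewrite /Q prodf_seq_neq0; apply/allP => i; rewrite mem_index_iota => /andP[_ hi].
by rewrite gt_eqF ?hook_factor_gt0 //; lia.
Qed.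

Lemma hook_den_S m : Q m.+1 = Q m * (X - al * m%:R).
Proof. by rewrite /Q big_nat_recr. Qed.

Lemma hook_den_cat k m : (k <= m)%N -> Q m = Q k * \prod_(k <= i < m) (X - al * i%:R).
Proof. by move=> km; rewrite /Q (big_cat_nat (n := k)). Qed.

(** [Q] is the integrating factor of the recursion: after division by [Q m.+1] it telescopes. *)
Lemma hook_sum m : (m <= n)%N ->
  z m / Q m = tau * (\sum_(k < m.+1) g k / Q k) - \sum_(k < m) g k / Q k.+1.
Proof.
elim: m => [|m IH] hm.
  by rewrite big_ord_recl !big_ord0 z0 /Q big_geq // !divr1 addr0 subr0.
have f0 : X - al * m%:R != 0 by rewrite gt_eqF ?hook_factor_gt0 //; lia.
have q0 := hook_den_neq0 (leqW (ltnW hm)); have q1 := hook_den_neq0 (leqW hm).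
have -> : z m.+1 / Q m.+1 = z m / Q m + tau * (g m.+1 / Q m.+1) - g m / Q m.+1.
  rewrite zS // hook_den_S; field; by rewrite q0 f0.
rewrite IH 1?ltnW // [X in _ = tau * X - _]big_ord_recr [X in _ = _ - X]big_ord_recr /=; ring.
Qed.

Lemma hook_identity :
  tau * (\sum_(k < n.+1) g k / Q k) = \sum_(k < n.+1) g k / Q k.+1.
Proof.
have := hook_sum (leqnn n); have q0 := hook_den_neq0 (leqnSn n).
have f0 : X - al * n%:R != 0 by rewrite gt_eqF ?hook_factor_gt0.
have -> : z n / Q n = g n / Q n.+1 by rewrite -zn hook_den_S; field; rewrite q0 f0.
by move=> e; rewrite [RHS]big_ord_recr /= e; ring.
Qed.

Definition hookpoly : {poly R} := \sum_(k < M.+1) g k *: falling al M k.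

(** [hook_identity] cleared of denominators: the falling products at X are [Q M / Q k], those at X -
    al are [Q M.+1 / Q k.+1]. *)
Lemma hookpoly_shift : tau * (X - al * M%:R) * hookpoly.[X] = hookpoly.[X - al].
Proof.
have tr (F : nat -> R) : \sum_(k < n.+1) g k * F k = \sum_(k < M.+1) g k * F k.
  rewrite -!(big_mkord xpredT (fun k => g k * F k)) (big_cat_nat (n := M.+1)) //=.
  by rewrite [X in _ + X]big_nat_cond [X in _ + X]big1 ?addr0 // => k; rewrite andbT ltnS => /gM ->; rewrite mul0r.
have := hook_identity; rewrite (tr (fun k => (Q k)^-1)) (tr (fun k => (Q k.+1)^-1)) => e.
have cut k : (k <= M)%N -> \prod_(k <= i < M) (X - al * i%:R) = Q M / Q k.
  move=> kM; rewrite (hook_den_cat kM) mulrAC divff ?mul1r //; apply: hook_den_neq0; lia.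
have eX : hookpoly.[X] = Q M * \sum_(k < M.+1) g k / Q k.
  rewrite /hookpoly horner_sum mulr_sumr; apply: eq_bigr => k _.
  rewrite hornerZ falling_eval cut; first ring.
  by rewrite -ltnS.
have eXa : hookpoly.[X - al] = Q M.+1 * \sum_(k < M.+1) g k / Q k.+1.
  rewrite /hookpoly horner_sum mulr_sumr; apply: eq_bigr => k _.
  rewrite hornerZ falling_eval mulrCA; congr (_ * _).
  have -> : \prod_(k <= i < M) (X - al - al * i%:R) = \prod_(k.+1 <= i < M.+1) (X - al * i%:R).
    by rewrite [RHS]big_add1; apply: eq_bigr => i _; rewrite -natr1; ring.
  have kM : (k.+1 <= M.+1)%N by rewrite ltn_ord.
  rewrite (hook_den_cat kM) mulrAC divff ?mul1r //.
  by apply: hook_den_neq0; apply: leq_trans kM _.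
by rewrite eX eXa -e hook_den_S; ring.
Qed.

End HookSystem.

(** * Coloured permutations *)

Section SubsetSums.
Variables (R : realType) (M : nat) (al : R) (h : 'I_M -> R).
Implicit Types (T U : {set 'I_M}) (i j x : 'I_M).

Lemma sum_subset_split (F : {set 'I_M} -> R) U x : x \in U ->
  \sum_(T : {set 'I_M} | T \subset U) F T = \sum_(T : {set 'I_M} | T \subset U :\ x) (F T + F (x |: T)).
Proof.
move=> xU; rewrite (bigID (fun T => x \in T)) /= addrC big_split /=; congr (_ + _).
  by apply: eq_bigl => T; rewrite subsetD1.
rewrite (reindex_onto (fun T => x |: T) (fun T => T :\ x)) /=; last first.
  by move=> T /andP[_ xT]; rewrite setD1K.
apply: eq_bigl => T; rewrite subUset sub1set xU setU11 /= andbT subsetD1.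
case: (boolP (T \subset U)) => //= _; apply/eqP/idP => [<-|xT]; last by rewrite setU1K.
by rewrite !inE eqxx.
Qed.

Definition after T i : nat := #|[set j in T | (i < j)%N]|.

(** With [h] the column lengths, the factor of i is leg + 1 + al arm for the first-row box of column
    i, in the shape formed by the columns of [T] alone. *)
Definition hookprod (h : 'I_M -> R) T : R := \prod_(i in T) (h i + al * (after T i)%:R).

Lemma after_sub T i0 : (forall j, j \in T -> (i0 < j)%N) ->
  forall i, i \in T -> after (i0 |: T) i = after T i.
Proof.
move=> hmin i iT; apply: eq_card => j; rewrite !inE; case: eqP => //= ->.
by have := hmin _ iT; case: (i0 \in T) => //=; lia.
Qed.

Lemma after_min T i0 : (forall j, j \in T -> (i0 < j)%N) -> after (i0 |: T) i0 = #|T|.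
Proof.
move=> hmin; apply: eq_card => j; rewrite !inE; case: eqP => [->|_] /=.
  by rewrite ltnn; apply/esym/negP => /hmin; rewrite ltnn.
by case: (boolP (j \in T)) => // /hmin.
Qed.

Lemma hookprodU1 k T i0 : (forall j, j \in T -> (i0 < j)%N) ->
  hookprod k (i0 |: T) = (k i0 + al * #|T|%:R) * hookprod k T.
Proof.
move=> hmin; have i0T : i0 \notin T by apply/negP => /hmin; rewrite ltnn.
rewrite /hookprod big_setU1 //= after_min //; congr (_ * _).
by apply: eq_bigr => i iT; rewrite after_sub.
Qed.

Lemma setmin U : U != set0 -> exists2 i0, i0 \in U & forall j, j \in U :\ i0 -> (i0 < j)%N.
Proof.
case/set0Pn => x xU; have [i0 i0U hmin] := @arg_minnP _ x (mem U) val xU.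
exists i0 => // j; rewrite !inE => /andP[ji jU].
by have := hmin j jU; rewrite leq_eqVlt => /orP[/eqP/val_inj e|//]; rewrite e eqxx in ji.
Qed.

Definition rising (y : R) m : R := \prod_(i < m) (y + al * i%:R).

(* A colouring with y further colours available at every position splits off the
   positions that use the further colours. *)
Lemma hookprod_shift y U :
  hookprod (fun i => h i + y) U = \sum_(T : {set 'I_M} | T \subset U) hookprod h T * rising y (#|U| - #|T|).
Proof.
have [m hm] := ubnP #|U|; elim: m U hm => // m IH U hm.
have [->|U0] := eqVneq U set0.
  rewrite (eq_bigl (pred1 set0)); last by move=> T; rewrite subset0.
  by rewrite big_pred1_eq /hookprod !big_set0 subnn /rising big_ord0 mulr1.
have [i0 i0U hmin] := setmin U0.
have cU : #|U| = #|U :\ i0|.+1 by rewrite (cardsD1 i0 U) i0U.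
rewrite (sum_subset_split _ i0U) -{1}(setD1K i0U) hookprodU1 // IH; last by rewrite -ltnS -cU.
rewrite mulr_sumr; apply: eq_bigr => T TU.
have tmin j : j \in T -> (i0 < j)%N by move=> jT; apply: hmin; exact: (subsetP TU).
have i0T : i0 \notin T by apply/negP => /tmin; rewrite ltnn.
rewrite hookprodU1 // cardsU1 i0T cU add1n subSS subSn ?subset_leq_card //.
rewrite /rising [in RHS]big_ord_recr /= natrB ?subset_leq_card //; ring.
Qed.

Definition hooksum k : R := \sum_(T : {set 'I_M} | #|T| == k) hookprod h T.

Lemma hooksum_shift y :
  hookprod (fun i => h i + y) [set: 'I_M] = \sum_(k < M.+1) hooksum k * rising y (M - k).
Proof.
have cM T : (#|T| < M.+1)%N by rewrite ltnS -[leqRHS]card_ord max_card.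
rewrite hookprod_shift cardsT card_ord.
rewrite (eq_bigl xpredT) => [|T]; last by rewrite subsetT.
rewrite (partition_big (fun T => Ordinal (cM T)) xpredT) //=; apply: eq_bigr => k _.
rewrite /hooksum mulr_suml; apply: eq_big => [T|T /eqP <-]; first by rewrite -val_eqE.
by [].
Qed.

Lemma hooksum_alt (u : R) : \sum_(T : {set 'I_M}) u ^+ (M - #|T|) * hookprod h T =
  \sum_(k < M.+1) u ^+ (M - k) * hooksum k.
Proof.
have cM T : (#|T| < M.+1)%N by rewrite ltnS -[leqRHS]card_ord max_card.
rewrite (partition_big (fun T => Ordinal (cM T)) xpredT) //=; apply: eq_bigr => k _.
rewrite /hooksum mulr_sumr; apply: eq_big => [T|T /eqP <-]; first by rewrite -val_eqE.
by [].
Qed.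

Lemma after_setT i : after [set: 'I_M] i = (M - i.+1)%N.
Proof.
rewrite /after (eq_card (B := [pred j : 'I_M | (i < j)%N])); last by move=> j; rewrite !inE.
rewrite -sum1_card -(big_mkord (fun l => (i < l)%N) (fun=> 1%N)) /=.
rewrite big_mkcond /= (big_cat_nat (n := i.+1)) //=.
rewrite big_nat_cond big1 ?add0n => [|l]; last by rewrite andbT => /andP[_ hl]; rewrite ltnNge -ltnS hl.
rewrite (eq_big_nat _ _ (F2 := fun=> 1%N)); last by move=> l /andP[-> _].
by rewrite sum_nat_const_nat muln1.
Qed.

End SubsetSums.

(** * Weighted count of coloured permutations by insertion *)

Section ColoredPerms.
Variables (R : realType) (M K : nat) (al : R) (h : 'I_M -> nat).
Hypothesis h_bound : forall i, (0 < h i <= K)%N.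
Hypothesis h_decr : forall i j : 'I_M, (i <= j)%N -> (h j <= h i)%N.
Local Notation coloring := {ffun 'I_M -> 'I_K.+1}.
Implicit Types (T : {set 'I_M}) (i j : 'I_M) (s t : {perm 'I_M}) (c : coloring).

(** Colour 1 is prescribed outside [T], in accordance with the fixed points of colour 1 that
    derangements forbid. *)
Definition colorings T s : {set coloring} :=
  [set c : coloring | [&& [forall i, (0 < c i <= h i)%N], [forall i, c i == c (s i)] &
     [forall i, (i \notin T) ==> (val (c i) == 1%N)]]].

Lemma coloringsP T s c : reflect
  [/\ forall i, (0 < c i <= h i)%N, forall i, c i = c (s i) & forall i, i \notin T -> val (c i) = 1%N]
  (c \in colorings T s).
Proof.
rewrite inE; apply: (iffP and3P) => -[h1 h2 h3]; split.
- exact/forallP.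
- by move=> i; apply/eqP; exact: (forallP h2).
- by move=> i iT; apply/eqP; exact: (implyP (forallP h3 i)).
- exact/forallP.
- by apply/forallP => i; apply/eqP.
- by apply/forallP => i; apply/implyP => iT; apply/eqP; exact: h3.
Qed.

Definition recolor i0 c (v : 'I_K.+1) : coloring := [ffun i => if i == i0 then v else c i].

Lemma recolor_at i0 c v : recolor i0 c v i0 = v. Proof. by rewrite ffunE eqxx. Qed.
Lemma recolor_off i0 c v i : i != i0 -> recolor i0 c v i = c i.
Proof. by rewrite ffunE => /negbTE ->. Qed.

Lemma colorings_fixed T s i0 : i0 \in T -> perm_on (T :\ i0) s ->
  #|colorings T s| = (h i0 * #|colorings (T :\ i0) s|)%N.
Proof.
move=> i0T ps; have si0 : s i0 = i0 by apply: out_perm ps _; rewrite !inE eqxx.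
have hs i : i != i0 -> s i != i0 by move=> ne; rewrite -si0 (inj_eq perm_inj).
have K1 : (1 < K.+1)%N by have := h_bound i0; lia.
pose V := [set v : 'I_K.+1 | (0 < v <= h i0)%N].
have cV : #|V| = h i0.
  by apply: card_ord_range; have /andP[] := h_bound i0.
pose f (p : 'I_K.+1 * coloring) := recolor i0 p.2 p.1.
have -> : colorings T s = f @: setX V (colorings (T :\ i0) s).
  apply/setP => c; apply/idP/imsetP => [/coloringsP[h1 h2 h3]|[[v c'] /setXP[/= hv /coloringsP[h1 h2 h3]] ->]].
    exists (c i0, recolor i0 c (Ordinal K1)); last first.
      by apply/ffunP => i; rewrite /f ffunE /=; case: eqP => [->|/eqP ne] //; rewrite recolor_off.
    apply/setXP; split; first by rewrite inE h1.
    apply/coloringsP; split=> i.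
    - have [->|ne] := eqVneq i i0; first by rewrite recolor_at /=; have := h_bound i0; lia.
      by rewrite recolor_off.
    - have [->|ne] := eqVneq i i0; first by rewrite si0.
      by rewrite !recolor_off ?hs.
    - have [->|ne] := eqVneq i i0; first by rewrite recolor_at.
      by rewrite !inE ne /= recolor_off // => /h3.
  apply/coloringsP; split=> i; rewrite /f /=.
  - have [->|ne] := eqVneq i i0; first by rewrite recolor_at; move: hv; rewrite inE.
    by rewrite recolor_off.
  - have [->|ne] := eqVneq i i0; first by rewrite si0.
    by rewrite !recolor_off ?hs.
  - have [->|ne] := eqVneq i i0; first by rewrite i0T.
    by rewrite recolor_off // => iT; apply: h3; rewrite !inE (negbTE iT) andbF.
rewrite card_in_imset ?cardsX ?cV // => -[v c] [v' c'] /setXP[_ /coloringsP[_ _ h3]] /setXP[_ /coloringsP[_ _ h3']] /= e.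
have e1 := congr1 (fun c : coloring => c i0) e; rewrite /f /= !recolor_at in e1.
rewrite e1; congr (_, _); apply/ffunP => i; have [->|ne] := eqVneq i i0.
  by apply: val_inj; rewrite h3 ?h3' // !inE eqxx.
by have := congr1 (fun c : coloring => c i) e; rewrite /f /= !recolor_off.
Qed.

(** The product inserts [i0] right after [j] in its cycle, so its colour must be that of [j]. This
    colour is admissible because [i0 < j] and column lengths decrease, whence the insertion from
    right to left. *)
Lemma colorings_insert T s i0 j : i0 \in T -> j \in T :\ i0 -> (i0 < j)%N ->
  perm_on (T :\ i0) s -> #|colorings T (tperm i0 j * s)%g| = #|colorings (T :\ i0) s|.
Proof.
move=> i0T jT ij ps; have si0 : s i0 = i0 by apply: out_perm ps _; rewrite !inE eqxx.
have hs i : i != i0 -> s i != i0 by move=> ne; rewrite -si0 (inj_eq perm_inj).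
have K1 : (1 < K.+1)%N by have := h_bound i0; lia.
have j0 : j != i0 by move: jT; rewrite !inE => /andP[].
pose f c := recolor i0 c (c j).
have -> : colorings T (tperm i0 j * s)%g = f @: colorings (T :\ i0) s.
  apply/setP => c; apply/idP/imsetP => [/coloringsP[h1 h2 h3]|[c' /coloringsP[h1 h2 h3] ->]].
    have cj : c i0 = c j by rewrite [RHS]h2 permM tpermR si0.
    exists (recolor i0 c (Ordinal K1)); last first.
      apply/ffunP => i; rewrite /f ffunE recolor_off // -cj.
      by case: eqP => [->|/eqP ne] //; rewrite recolor_off.
    apply/coloringsP; split=> i.
    - have [->|ne] := eqVneq i i0; first by rewrite recolor_at /=; have := h_bound i0; lia.
      by rewrite recolor_off.
    - have [->|ne] := eqVneq i i0; first by rewrite si0.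
      rewrite !recolor_off ?hs //; have [->|nj] := eqVneq i j.
        by rewrite -cj (h2 i0) permM tpermL.
      by rewrite [LHS](h2 i) permM tpermD // eq_sym.
    - have [->|ne] := eqVneq i i0; first by rewrite recolor_at.
      by rewrite !inE ne /= recolor_off // => /h3.
  apply/coloringsP; split=> i; rewrite /f /=.
  - have [->|ne] := eqVneq i i0; last by rewrite recolor_off.
    rewrite recolor_at; have /andP[-> hj] := h1 j; apply: leq_trans hj _.
    exact/h_decr/ltnW.
  - rewrite permM; case: tpermP => [->|->|/eqP n1 /eqP n2].
    + by rewrite recolor_at recolor_off ?hs // -h2.
    + by rewrite si0 recolor_at recolor_off.
    + by rewrite !recolor_off ?hs // -h2.
  - have [->|ne] := eqVneq i i0; first by rewrite i0T.
    by rewrite recolor_off // => iT; apply: h3; rewrite !inE (negbTE iT) andbF.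
rewrite card_in_imset // => c c' /coloringsP[_ _ h3] /coloringsP[_ _ h3'] /= e.
apply/ffunP => i; have [->|ne] := eqVneq i i0.
  by apply: val_inj; rewrite h3 ?h3' // !inE eqxx.
by have := congr1 (fun c : coloring => c i) e; rewrite /f /= !recolor_off.
Qed.

Definition cycweight s : R := al ^+ (M - #|porbits s|).

Lemma card_porbits_le s : (#|porbits s| <= M)%N.
Proof. by rewrite -[leqRHS]card_ord; exact: leq_imset_card. Qed.

Lemma porbit_fixed s i : s i = i -> porbit s i = [set i].
Proof.
move=> e; apply/setP => x; rewrite inE; apply/porbitP/eqP => [[k ->]|->]; last by exists 0%N; rewrite expg0 perm1.
by elim: k => [|k IH]; rewrite ?expg0 ?perm1 // expgSr permM IH.
Qed.

Lemma cycweight_insert s i0 j : s i0 = i0 -> j != i0 ->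
  cycweight (tperm i0 j * s)%g = al * cycweight s.
Proof.
move=> si0 ji; have := porbits_mul_tperm s i0 j.
have -> : i0 \notin porbit s j.
  by rewrite porbit_sym porbit_fixed // inE.
rewrite [i0 == j]eq_sym ji /= /cycweight -exprS => e; congr (_ ^+ _).
have hle := card_porbits_le s.
have aux a b : (b <= M -> a + 2 = b + 1 -> M - a = (M - b).+1)%N by lia.
exact: aux hle e.
Qed.

Lemma perm_on_insert T s i0 j : i0 \in T -> j \in T ->
  perm_on T (tperm i0 j * s)%g && ((tperm i0 j * s)^-1%g i0 == j) = perm_on (T :\ i0) s.
Proof.
move=> i0T jT; have tT : perm_on T (tperm i0 j).
  apply/subsetP => x; rewrite inE; case: tpermP => [-> //|-> //|]; by rewrite eqxx.
have -> : perm_on T (tperm i0 j * s)%g = perm_on T s.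
  apply/idP/idP => hp; last exact: perm_onM.
  by rewrite -[s](mulKg (tperm i0 j)) tpermV; exact: perm_onM.
have -> : ((tperm i0 j * s)^-1%g i0 == j) = (s i0 == i0).
  by rewrite -(inj_eq (@perm_inj _ (tperm i0 j * s)%g)) permKV permM tpermR eq_sym.
apply/andP/idP => [[h1 h2]|hp].
  apply/subsetP => x; rewrite !inE => hx; apply/andP; split; first by apply: contraNneq hx => ->.
  by apply: (subsetP h1); rewrite inE.
split; last by apply/eqP; apply: out_perm hp _; rewrite !inE eqxx.
by apply/subsetP => x hx; have := subsetP hp x hx; rewrite !inE => /andP[].
Qed.

(** Permutations are sorted by the preimage [j] of [i0]; [j = i0] is the case of a fixed point. *)
Lemma sum_perm_on (F : {perm 'I_M} -> R) T i0 : i0 \in T ->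
  \sum_(s | perm_on T s) F s = \sum_(j in T) \sum_(s | perm_on (T :\ i0) s) F (tperm i0 j * s)%g.
Proof.
move=> i0T; rewrite (partition_big (fun s : {perm 'I_M} => (s^-1)%g i0) (mem T)) /=; last first.
  by move=> s hs; rewrite perm_closed ?perm_onV.
apply: eq_bigr => j jT.
rewrite (reindex_inj (mulgI (tperm i0 j))) /=; apply: eq_bigl => s.
exact: perm_on_insert.
Qed.

(** The least position [i0] either forms a new cycle in one of [h i0] colours, or is inserted after
    one of the other positions at the price of [al]: this is the factor in [hookprodU1]. *)
Lemma colored_weight T :
  \sum_(s | perm_on T s) cycweight s * #|colorings T s|%:R =
  hookprod al (fun i => (h i)%:R) T.
Proof.
have [m hm] := ubnP #|T|; elim: m T hm => // m IH T hm.
have [->|T0] := eqVneq T set0.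
  rewrite /hookprod big_set0 (eq_bigl (pred1 1%g)) => [|s]; last first.
    apply/idP/eqP => [hp|->]; last exact: perm_on1.
    by apply/permP => x; rewrite perm1; apply: out_perm hp _; rewrite inE.
  rewrite big_pred1_eq /cycweight.
  have -> : #|porbits (1 : {perm 'I_M})%g| = M.
    rewrite /porbits card_imset ?card_ord // => x y; rewrite !porbit_fixed ?perm1 //.
    exact: set1_inj.
  rewrite subnn expr0 mul1r (_ : colorings _ _ = [set [ffun => inord 1]]) ?cards1 //.
  apply/setP => c; rewrite [in RHS]inE; apply/coloringsP/eqP => [[h1 h2 h3]|->].
    by apply/ffunP => i; rewrite ffunE; apply: val_inj; rewrite h3 ?inE //= inordK //; have := h_bound i; lia.
  by split=> [i|i|i _]; rewrite ?ffunE //= inordK; have := h_bound i; lia.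
have [i0 i0T hmin] := setmin T0.
have cT : #|T| = #|T :\ i0|.+1 by rewrite (cardsD1 i0 T) i0T.
rewrite -[in RHS](setD1K i0T) hookprodU1 // -IH; last by rewrite -ltnS -cT.
rewrite (sum_perm_on _ i0T) (big_setD1 i0) //= mulrDl; congr (_ + _).
  rewrite mulr_sumr; apply: eq_bigr => s hs; rewrite tperm1 mul1g (colorings_fixed i0T hs) natrM; ring.
rewrite (eq_bigr (fun=> \sum_(s | perm_on (T :\ i0) s) al * (cycweight s * #|colorings (T :\ i0) s|%:R))).
  by rewrite sumr_const -mulr_sumr -mulr_natr; ring.
move=> j jT; apply: eq_bigr => s hs.
have j0 : j != i0 by move: jT; rewrite !inE => /andP[].
rewrite colorings_insert ?hmin // cycweight_insert // ?mulrA //.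
by apply: out_perm hs _; rewrite !inE eqxx.
Qed.

End ColoredPerms.

(** * The main theorem *)

Section Derangements.
Variables (R : realType) (n : nat) (la : intpart n) (al : R).
Hypothesis n_gt0 : (0 < n)%N.
Let M := part1 la.
Let h (i : 'I_M) := conj_part la i.+1.

Lemma part_le_part1 k : k \in (la : seq nat) -> (k <= M)%N.
Proof.
rewrite /M /part1; have := sorted_intpart la; case: (la : seq nat) => //= a s hs.
rewrite inE => /orP[/eqP-> //|ks].
by have /allP := order_path_min geq_trans hs; exact.
Qed.

Lemma part1_mem : M \in (la : seq nat).
Proof.
rewrite /M /part1; have := sumn_intpart la; case: (la : seq nat) => [|a s] /=; last by rewrite inE eqxx.
by move=> e; move: n_gt0; rewrite -e.
Qed.

Lemma part1_le : (M <= n)%N.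
Proof. by rewrite -(sumn_intpart la); apply: leq_sumn; exact: part1_mem. Qed.

Lemma part1_gt0 : (0 < M)%N.
Proof. by rewrite lt0n; apply: contraTneq part1_mem => ->; exact: intpart_n0. Qed.

Lemma conj_bound i : (0 < h i <= n)%N.
Proof.
rewrite /h /conj_part; apply/andP; split; last first.
  exact: leq_trans (count_size _ _) (size_intpart _).
by rewrite -has_count; apply/hasP; exists M; [exact: part1_mem|exact: ltn_ord].
Qed.

Lemma conj_decr (i j : 'I_M) : (i <= j)%N -> (h j <= h i)%N.
Proof. by move=> ij; apply: sub_count => k /=; apply: leq_trans. Qed.

Lemma derangement_weight : jack_derangement la al =
  \sum_(cs in colored_derangements la) cycweight al cs.2.
Proof.
rewrite /jack_derangement.
rewrite (eq_big_nat _ _ (F2 := fun k => \sum_(cs in colored_derangements la)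
    (if #|porbits cs.2| == k then al ^+ (M - k) else 0))).
  rewrite exchange_big /=; apply: eq_bigr => cs _.
  (* As la_1 > 0 there is at least one cycle, so starting the sum at k = 1 loses nothing. *)
  have hk : #|porbits cs.2| \in index_iota 1 M.+1.
    rewrite mem_index_iota ltnS card_porbits_le andbT; apply/card_gt0P.
    by exists (porbit cs.2 (Ordinal part1_gt0)); apply: imset_f.
  rewrite (bigD1_seq _ hk) ?iota_uniq //= eqxx big1 ?addr0 // => k /negbTE.
  by rewrite eq_sym => ->.
move=> k _; rewrite /derangements_cycles -/M -big_mkcondr sumr_const mulr_natl.
by congr (_ *+ _); apply: eq_card => cs; rewrite [LHS]inE.
Qed.

(** Inclusion-exclusion over the complement of [T], whose positions are forced to be fixed points of
    colour 1; what remains is a coloured permutation supported on [T]. *)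
Lemma derangement_hookprod : jack_derangement la al =
  \sum_(T : {set 'I_M}) (-1) ^+ (M - #|T|) * hookprod al (fun i => (h i)%:R) T.
Proof.
rewrite derangement_weight.
pose bad (cs : colored_perm n la) i := (cs.2 i == i) && (val (cs.1 i) == 1%N).
have -> : \sum_(cs in colored_derangements la) cycweight al cs.2 =
   \sum_(cs in colored_perms la) (\prod_i (1 + - (bad cs i)%:R)) * cycweight al cs.2.
  rewrite big_mkcond [RHS]big_mkcond; apply: eq_bigr => cs _.
  rewrite [cs \in colored_derangements la]inE; case: (cs \in colored_perms la) => //=.
  case: (boolP [forall i, _]) => H.
    rewrite big1 ?mul1r // => i _; rewrite /bad; have := forallP H i.
    by case: (cs.2 i == i) => /= [/negbTE ->|_]; rewrite oppr0 addr0.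
  have [i hi] := forallPn H; rewrite (bigD1 i) //= /bad; move: hi; rewrite negb_imply negbK => ->.
  by rewrite subrr !mul0r.
rewrite (eq_bigr (fun cs : colored_perm n la => \sum_(T : {set 'I_M}) (-1) ^+ (M - #|T|) *
  ((\prod_(i | i \notin T) (bad cs i)%:R) * cycweight al cs.2))); last first.
  move=> cs _; rewrite bigA_distr mulr_suml; apply: eq_bigr => T _.
  rewrite mulrA; congr (_ * _).
  rewrite (bigID (fun i => i \in T)) /= big1 ?mul1r => [|i -> //].
  rewrite (eq_bigr (fun i => (-1) * (bad cs i)%:R)) => [|i /negbTE ->]; last by rewrite mulN1r.
  rewrite big_split /= prodr_const; congr (_ ^+ _ * _).
  have aux a b c : (a + b = c -> b = c - a)%N by lia.
  have := cardsC T; rewrite card_ord => /aux <-; apply: eq_card => i; by rewrite !inE.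
rewrite exchange_big /=; apply: eq_bigr => T _; rewrite -mulr_sumr; congr (_ * _).
rewrite -(@colored_weight R M n al h conj_bound conj_decr).
rewrite (eq_bigr (fun s => \sum_(c in @colorings M n h T s) cycweight al s)); last first.
  by move=> s _; rewrite sumr_const mulr_natr.
rewrite (exchange_big_dep xpredT) //= pair_big_dep /= [LHS]big_mkcond [RHS]big_mkcond /=.
apply: eq_bigr => -[c s] _ /=.
have -> : (c, s) \in colored_perms la =
   [forall i, (0 < c i <= h i)%N] && [forall i, c i == c (s i)] by rewrite inE.
rewrite [c \in _]inE /=.
case: [forall i, (0 < c i <= h i)%N] => //=; last by rewrite andbF.
case: [forall i, c i == c (s i)] => //=; last by rewrite andbF.
case: (boolP (perm_on T s && _)) => H.
  case/andP: H => h1 /forallP h2; rewrite big1 ?mul1r // => i iT.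
  by rewrite /bad /= (out_perm h1 iT) eqxx (implyP (h2 i) iT).
suff /existsP[i /andP[iT hi]] : [exists i, (i \notin T) && ~~ bad (c, s) i].
  by rewrite (bigD1 i) //= (negbTE hi) !mul0r.
apply: contraNT H => /existsPn H; apply/andP; split.
  apply/subsetP => i; rewrite inE => hi; have := H i; rewrite negb_and !negbK /bad /= (negbTE hi).
  by rewrite orbF.
apply/forallP => i; apply/implyP => iT; have := H i; rewrite negb_and !negbK (negbTE iT) /=.
by case/andP.
Qed.

End Derangements.

(** * The theorem for positive alpha *)

Section Positive.
Variables (R : realType) (n : nat) (al : R) (J : intpart n -> Defs.symf R n).
Hypotheses (n_gt0 : (0 < n)%N) (al0 : 0 < al) (Jbasis : symf_basis J).
Hypothesis Jorth : forall la mu, la != mu -> jack_dot al (J la) (J mu) = 0.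
Hypothesis Jmono : forall la, exists c : intpart n -> R,
  [/\ monomial_expansion (J la) c, forall mu, ~~ dominated mu la -> c mu = 0
    & forall mu, parts mu = nseq n 1%N -> c mu = n`!%:R].
Variable la : intpart n.
Let M := part1 la.
Let Mn : (M <= n)%N := part1_le la n_gt0.
Let h (i : 'I_M) : R := (conj_part la i.+1)%:R.

(** This is the normalisation of J_la at m_(1^n); it makes the hook polynomial monic. *)
Lemma gcoef0 : gcoef J la 0 = 1.
Proof.
have [||mu hmu] := @exists_intpart n (nseq n 1%N); rewrite ?mem_nseq ?andbF ?sumn_nseq ?mul1n //.
have emu : parts mu = nseq n 1%N.
  have e := perm_size hmu; rewrite size_nseq in e.
  rewrite -[X in nseq X _]e; apply/all_pred1P/allP => x.
  by rewrite (perm_mem hmu) mem_nseq => /andP[_ /eqP ->] /=.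
have := mcoef_ones Jmono la emu; rewrite /mcoef.
have -> : emb n mu = hook 0 (hookset n 0).
  apply/mnmP => i; rewrite !mnmE emu inE subn0.
  case: i => [[|i] hi] //=; rewrite nth_nseq -ltnS; by case: ltnP.
rewrite jcoeff_hook ?card_hookset ?ord0_hookset // subn0.
have f0 : n`!%:R != 0 :> R by rewrite pnatr_eq0 -lt0n fact_gt0.
by move=> e; apply: (mulfI f0); rewrite e mulr1.
Qed.

Lemma gcoef_large k : (M < k <= n)%N -> gcoef J la k = 0.
Proof.
move=> /andP[Mk kn]; have := jcoeff_hook J la kn (ord0_hookset n k) (card_hookset n k).
rewrite (jcoeff_dom Jmono) => [/esym/eqP|]; last first.
  (* At threshold la_1 the excess of [la] is 0, while an exponent k > la_1 has positive excess. *)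
  move=> /(_ M); rewrite [X in (_ <= X)%N]excess_upper; last first.
    by apply/allP => x; exact: part_le_part1.
  have [r [hr _]] := perm_mnm1_eq (b := hook k (hookset n k)) (b' := hook k (hookset n k)) (j := ord0) (fun _ _ => erefl).
  by rewrite (excess_perm M hr) /excess big_cons hook0; lia.
by rewrite mulf_eq0 pnatr_eq0 (gtn_eqF (fact_gt0 _)) => /eqP.
Qed.

Let P := hookpoly M al (gcoef J la).
Let Q : {poly R} := \prod_(i < M) ('X - (al * i%:R - (conj_part la i.+1)%:R)%:P).

Lemma colpoly_eval X : Q.[X] = \prod_(0 <= i < M) (X - al * i%:R + (conj_part la i.+1)%:R).
Proof.
rewrite big_mkord /Q horner_prod; apply: eq_bigr => i _; rewrite !hornerE; ring.
Qed.

Lemma conj_part_large : conj_part la M.+1 = 0%N.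
Proof.
apply/eqP; rewrite eqn0Ngt -has_count; apply/hasPn => k kla; rewrite /= -leqNgt.
exact: part_le_part1.
Qed.

Lemma hookpoly_colpoly X : al * n%:R < X -> P.[X - al] * Q.[X] = P.[X] * Q.[X - al].
Proof.
move=> Xbig; have [z hz] := resolvent_exists al0 Xbig (extend (J la)).
have den_gt0 i : (i <= n)%N -> 0 < X - al * i%:R + (count (leq i.+1) la)%:R.
  by move=> hi; rewrite ltr_wpDr ?ler0n // (hook_factor_gt0 al0 Xbig).
have den_neq0 i : (i <= n)%N -> X - al * i%:R + (count (leq i.+1) la)%:R != 0.
  by move=> hi; rewrite gt_eqF ?den_gt0.
(* For r > la_1 no part exceeds r, and the recursion only asks for the inverse of its left
   factor. *)
pose v r := if (r <= M)%N then top_coef al X la M r else (X - al * r%:R + (count (leq r.+1) la)%:R)^-1.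
have hv r : (r <= n)%N -> (X - al * r%:R + (count (leq r.+1) la)%:R) * v r =
     1 + \sum_(k <- la | (r < k)%N) v k.
  move=> hr; rewrite /v; case: leqP => hrM.
    rewrite (@top_coef_eq _ al X la M) //; last 2 first.
    - by move=> k; exact: part_le_part1.
    - by move=> i hi; apply: den_neq0; exact: leq_trans hi Mn.
    congr (_ + _); rewrite big_seq_cond [RHS]big_seq_cond; apply: eq_bigr => k /andP[kla _].
    by rewrite part_le_part1.
  rewrite divff ?den_neq0 // big_seq_cond big1 ?addr0 // => k /andP[kla rk].
  by have := part_le_part1 kla; rewrite -/M; lia.
have hE := resolvent_eigen al0 Jbasis Jorth Jmono Xbig hz hv.
have Zeq b : X * expand z b - cherednik al (expand z) b = jcoeff J la b.
  by rewrite (resolvent_expand _ hz) expand_extend.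
have tauE := hookpoly_shift Mn al0 Xbig (hookval_step Zeq hE) (hookval_first hE) (hookval_last Zeq hE) gcoef_large.
have Qden : Q.[X] * (X - al * M%:R) = \prod_(0 <= i < M.+1) (X - al * i%:R + (conj_part la i.+1)%:R).
  by rewrite colpoly_eval big_nat_recr //= conj_part_large addr0.
have Qnum : Q.[X - al] = \prod_(1 <= i < M.+1) (X - al * i%:R + (conj_part la i)%:R).
  by rewrite colpoly_eval big_add1 /=; apply: eq_bigr => i _; rewrite -natr1; ring.
(* The eigenvalue is the product of numerators over i = 1, ..., M divided by that of denominators
   over i = 0, ..., M; the last denominator is X - al M because column M + 1 is empty. *)
have vQ : v 0%N * (Q.[X] * (X - al * M%:R)) = Q.[X - al].
  rewrite Qden big_ltn // mulrA /v /top_coef leq0n.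
  rewrite mulfVK ?den_neq0 // Qnum -big_split /=.
  rewrite big_nat [RHS]big_nat; apply: eq_bigr => i /andP[_ hi]; rewrite divfK //.
  by apply: den_neq0; rewrite -ltnS; apply: leq_trans hi _.
rewrite -tauE -/P -vQ; ring.
Qed.

Lemma colpoly_monic : Q \is monic.
Proof. by apply: monic_prod => i _; rewrite monicXsubC. Qed.
Lemma colpoly_size : size Q = M.+1.
Proof. by rewrite /Q size_prod_XsubC -[index_enum _]enumT size_enum_ord. Qed.

Lemma hookpoly_top : P = falling al M 0 + \sum_(i < M) gcoef J la i.+1 *: falling al M i.+1.
Proof. by rewrite /P /hookpoly big_ord_recl gcoef0 scale1r. Qed.

Lemma hookpoly_low : (size (\sum_(i < M) gcoef J la i.+1 *: falling al M i.+1)%R < size (falling al M 0))%N.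
Proof.
rewrite falling_size subn0 ltnS; apply: (leq_trans (size_sum _ _ _)); apply/bigmax_leqP => i _.
apply: leq_trans (size_scale_leq _ _) _; rewrite falling_size; have := ltn_ord i; lia.
Qed.

Lemma hookpoly_eq_colpoly : P = Q.
Proof.
apply: (monic_shift_eq al0 _ colpoly_monic _ _ hookpoly_colpoly).
- by rewrite monicE hookpoly_top lead_coefDl ?hookpoly_low // -monicE falling_monic.
- by rewrite hookpoly_top size_polyDl ?hookpoly_low // falling_size subn0 colpoly_size.
move=> X Xbig; rewrite colpoly_eval prodf_seq_neq0; apply/allP => i; rewrite mem_index_iota => /andP[_ hi] /=.
rewrite gt_eqF // ltr_wpDr ?ler0n // (hook_factor_gt0 al0 Xbig) //.
exact: leq_trans (ltnW hi) Mn.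
Qed.

Lemma colpoly_hooksum : Q = \sum_(k < M.+1) hooksum al h k *: falling al M k.
Proof.
apply/eqP; rewrite -subr_eq0; apply/eqP; apply: (@poly_ray_eq0 _ _ 0 1); first exact: oner_neq0.
move=> m; set X := 0 + _; rewrite hornerD hornerN; apply/eqP; rewrite subr_eq0; apply/eqP.
(* Chosen so that y + al (M - i - 1) = X - al i: the shifted hook product over all columns is then
   Q(X), and [rising] read backwards is [falling]. *)
pose y := X - al * (M%:R - 1).
transitivity (hookprod al (fun i => h i + y) [set: 'I_M]).
  rewrite colpoly_eval big_mkord /hookprod; apply: eq_big => [i|i _]; first by rewrite inE.
  rewrite after_setT natrB // -natr1 /y /h; ring.
rewrite hooksum_shift horner_sum; apply: eq_bigr => k _; rewrite hornerZ falling_eval; congr (_ * _).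
rewrite /rising -(big_mkord xpredT (fun i => y + al * i%:R)) -[X in _ = \prod_(X <= _ < _) _]add0n big_addn big_nat_rev /=.
rewrite big_nat [RHS]big_nat; apply: eq_bigr => i /andP[_ hi]; have kM := ltn_ord k; rewrite add0n.
have -> : (M - k - i.+1)%N = (M - (i + k).+1)%N by lia.
by rewrite natrB; [rewrite -natr1 /y; ring|lia].
Qed.

Lemma gcoef_hooksum k : (k <= M)%N -> gcoef J la k = hooksum al h k.
Proof.
move=> hk; apply/eqP; rewrite -subr_eq0; apply/eqP; move: k hk.
apply: (@falling_free _ al M (fun k => gcoef J la k - hooksum al h k)); first by rewrite gt_eqF.
rewrite (eq_bigr (fun k : 'I_M.+1 => gcoef J la k *: falling al M k - hooksum al h k *: falling al M k)).
  by rewrite sumrB -colpoly_hooksum -hookpoly_eq_colpoly subrr.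
by move=> k _; rewrite scalerBl.
Qed.

Lemma sum_no_ones : \sum_(mu : intpart n | part_mult mu 1 == 0%N) J la mu =
  \sum_(k < n.+1) (-1) ^+ (n - k) * gcoef J la k.
Proof.
rewrite /gcoef (eq_bigr (fun k : 'I_n.+1 => \sum_mu J la mu * ((-1) ^+ (n - k) * 'C(count_mem 1%N mu, n - k)%:R))); last first.
  by move=> k _; rewrite mulr_sumr; apply: eq_bigr => mu _; ring.
rewrite exchange_big big_mkcond /=; apply: eq_bigr => mu _; rewrite -mulr_sumr /part_mult.
set m := count_mem 1%N mu.
have mn : (m <= n)%N by apply: leq_trans (size_intpart mu); exact: count_size.
(* The alternating sum is (1 - 1)^m with 0^0 = 1; since m <= n, the range of k covers all nonzero
   binomials. *)
suff -> : \sum_(k < n.+1) (-1) ^+ (n - k) * 'C(m, n - k)%:R = (m == 0%N)%:R :> R.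
  by case: eqP => _; rewrite ?mulr1 ?mulr0.
rewrite (reindex_inj rev_ord_inj) /=.
rewrite (eq_bigr (fun k : 'I_n.+1 => (-1) ^+ k * 'C(m, k)%:R)) => [|k _]; last first.
  by rewrite subSS subKn // -ltnS.
rewrite -(big_mkord xpredT (fun k => (-1) ^+ k * 'C(m, k)%:R : R)) (big_cat_nat (n := m.+1)) //=.
rewrite [X in _ + X]big_nat_cond [X in _ + X]big1 ?addr0 => [|k]; last first.
  by rewrite andbT => /andP[mk _]; rewrite bin_small // mulr0.
rewrite big_mkord -expr0n -[X in _ = X ^+ _](subrr (1 : R)) exprBn; apply: eq_bigr => k _.
by rewrite !expr1n !mulr1 mulr_natr.
Qed.

Lemma eta_positive : \sum_(mu : intpart n | part_mult mu 1 == 0%N) J la mu =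
  (-1) ^+ (n - part1 la) * jack_derangement la al.
Proof.
rewrite sum_no_ones (derangement_hookprod _ _ n_gt0) -/M -/h hooksum_alt mulr_sumr.
rewrite -(big_mkord xpredT (fun k => (-1) ^+ (n - k) * gcoef J la k)) (big_cat_nat (n := M.+1)) //=.
rewrite [X in _ + X]big_nat_cond [X in _ + X]big1 ?addr0 => [|k]; last first.
  by rewrite andbT ltnS => hk; rewrite gcoef_large ?mulr0.
rewrite big_mkord; apply: eq_bigr => k _; have hk : (k <= M)%N by rewrite -ltnS.
by rewrite gcoef_hooksum // mulrA -exprD; congr (_ ^+ _ * _); lia.
Qed.

End Positive.

Theorem theorem1 (R : realType)
    (theta : forall n : nat, intpart n -> intpart n -> {poly R})
    (theta_jack : is_jack_theta theta)
    (n : nat) (n_gt0 : (0 < n)%N) (la : intpart n) (alpha : R) :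
  jack_eta theta la alpha = (-1) ^+ (n - part1 la) * jack_derangement la alpha.
Proof.
pose E : {poly R} := \sum_(mu : intpart n | part_mult mu 1 == 0%N) theta n la mu.
pose D : {poly R} := (-1) ^+ (n - part1 la) *:
  \sum_(1 <= k < (part1 la).+1) (derangements_cycles la k)%:R *: 'X^(part1 la - k).
have etaE a : jack_eta theta la a = E.[a] by rewrite /E horner_sum.
have derE a : (-1) ^+ (n - part1 la) * jack_derangement la a = D.[a].
  rewrite /D hornerZ horner_sum; congr (_ * _); apply: eq_bigr => k _.
  by rewrite hornerZ hornerXn.
rewrite etaE derE; suff -> : E = D by [].
(* The Jack characterization is available at positive parameters; the points 1, 2, 3, ... are enough
   to identify two polynomials. *)
apply/eqP; rewrite -subr_eq0; apply/eqP; apply: (@poly_ray_eq0 _ _ 1 1); first exact: oner_neq0.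
move=> m; set a := 1 + _; have a0 : 0 < a by rewrite ltr_pwDl // mulr1 ler0n.
rewrite hornerD hornerN; apply/eqP; rewrite subr_eq0 -etaE -derE; apply/eqP.
have [Jb Jo Jm] := theta_jack a a0.
rewrite -(eta_positive n_gt0 a0 (Jb n) (Jo n) (Jm n) la).
by apply: eq_bigr => mu _; rewrite ffunE.
Qed.
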